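(* Let $K\ge1$ be fixed, let $\boldsymbol{\beta}_0\in\mathbb{R}^K$, and for each $n$ let $\mathbf{x}_1,\dots,\mathbf{x}_n\in\mathbb{R}^K$ (rows of the $n\times K$ design matrix $\mathbf{X}$) satisfy: (i) $\sum_{i=1}^n x_{i,k}=0$ and $\sum_{i=1}^n x_{i,k}^2=n$ for each $k$; (ii) $\max_{1\le i\le n}\|\mathbf{x}_i\|/\sqrt n\to0$; (iii) $\mathbf{X}^t\mathbf{X}$ is positive definite; (iv) $\mathbf{X}^t\mathbf{X}/n\to\boldsymbol{\Sigma}_0$ with $\boldsymbol{\Sigma}_0$ positive definite. Suppose the data follow $Y_{ni}=\mathbf{x}_i^t\boldsymbol{\beta}_n+\varepsilon_{ni}$, $i=1,\dots,n$, with $\boldsymbol{\beta}_n=\boldsymbol{\beta}_0/\sqrt n$, where for each $n$ the $\varepsilon_{n1},\dots,\varepsilon_{nn}$ are independent with $\mathbb{E}(\varepsilon_{ni})=0$, $\mathbb{E}(\varepsilon_{ni}^2)=1$ and $\mathbb{E}(\varepsilon_{ni}^4)\le M$ for some $M<\infty$. Let $Y_{ni}^*=\sqrt n\,Y_{ni}$, $\mathbf{Y}_n^*=(Y_{n1}^*,\dots,Y_{nn}^* )^t$, and consider the Bayesian model $(Y_{ni}^*\mid\mathbf{x}_i,\boldsymbol{\beta})$ independent $N(\mathbf{x}_i^t\boldsymbol{\beta},n)$, $(\boldsymbol{\beta}\mid\boldsymbol{\gamma})\sim\nu(d\boldsymbol{\beta}\mid\boldsymbol{\gamma})$, $\boldsymbol{\gamma}\sim\pi$,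 and suppose the marginal prior $\nu$ of $\boldsymbol{\beta}$ has a density $f$ that is continuous and positive everywhere. Let $\nu_n(\cdot\mid\mathbf{Y}_n^* )$ be the posterior of $\boldsymbol{\beta}$. Then for each $\boldsymbol{\beta}_1\in\mathbb{R}^K$ and each $C>0$, $$\log\left(\frac{\nu_n(S(\boldsymbol{\beta}_1,C/\sqrt n)\mid\mathbf{Y}_n^* )}{\nu_n(S(\boldsymbol{\beta}_0,C/\sqrt n)\mid\mathbf{Y}_n^* )}\right)\rightsquigarrow \log\left(\frac{f(\boldsymbol{\beta}_1)}{f(\boldsymbol{\beta}_0)}\right)-\frac12(\boldsymbol{\beta}_1-\boldsymbol{\beta}_0)^t\boldsymbol{\Sigma}_0(\boldsymbol{\beta}_1-\boldsymbol{\beta}_0)+(\boldsymbol{\beta}_1-\boldsymbol{\beta}_0)^t\mathbf{Z}$$ in distribution, where $\mathbf{Z}\sim N(\mathbf{0},\boldsymbol{\Sigma}_0)$.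
   Context: $S(\boldsymbol{\beta},r)$ denotes the (Euclidean) ball in $\mathbb{R}^K$ centered at $\boldsymbol{\beta}$ with radius $r>0$. $\|\cdot\|$ is the Euclidean norm. $\rightsquigarrow$ denotes convergence in distribution as $n\to\infty$. *)

(* Defs.v *)
From HB Require Import structures.
From mathcomp Require Import all_boot all_order all_algebra.
From mathcomp Require Import all_classical all_reals all_analysis.
Set Implicit Arguments.
Unset Strict Implicit.
Unset Printing Implicit Defensive.
Import Order.TTheory GRing.Theory Num.Theory.
Import numFieldNormedType.Exports.
Local Open Scope classical_set_scope.
Local Open Scope ereal_scope.
Local Open Scope ring_scope.

Section defs.
Variable R : realType.

Definition dotv (K : nat) (u v : 'rV[R]_K) : R := \sum_(k < K) u 0 k * v 0 k.
Definition enorm (K : nat) (v : 'rV[R]_K) : R := Num.sqrt (dotv v v).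

Definition eball (K : nat) (b : 'rV[R]_K) (r : R) : set 'rV[R]_K :=
  [set v | enorm (v - b) < r].

Definition quadf (K : nat) (A : 'M[R]_K) (u : 'rV[R]_K) : R :=
  \sum_(j < K) \sum_(k < K) u 0 j * A j k * u 0 k.

Definition posdef (K : nat) (A : 'M[R]_K) : Prop :=
  forall u : 'rV[R]_K, u != 0 -> 0 < quadf A u.

(* Lebesgue integral over R^K of a nonnegative function, as the iterated
   integral w.r.t. one-dimensional Lebesgue measure (equal to the integral
   w.r.t. K-dimensional Lebesgue measure by Tonelli, for measurable
   nonnegative integrands). *)
Fixpoint iint (K : nat) (g : seq R -> \bar R) : \bar R :=
  match K with
  | 0 => g [::]
  | K'.+1 => (\int[@lebesgue_measure R]_t iint K' (fun s => g (t :: s)))%E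
  end.

Definition leb_intK (K : nat) (g : 'rV[R]_K -> \bar R) : \bar R :=
  iint K (fun s => g (\row_(k < K) nth 0 s k)).

Definition npdf (m v y : R) : R :=
  expR (- (y - m) ^+ 2 / (2 * v)) / Num.sqrt (2 * pi * v).

Definition posterior (K : nat) (f L : 'rV[R]_K -> R) (A : set 'rV[R]_K) : R :=
  fine (leb_intK (fun b => (\1_A b * f b * L b)%:E)) /
  fine (leb_intK (fun b => (f b * L b)%:E)).

Definition mutually_independent d (T : measurableType d) (P : probability T R)
  (n : nat) (X : 'I_n -> T -> R) : Prop :=
  forall B : 'I_n -> set R, (forall i, measurable (B i)) ->
    P (\bigcap_(i in [set: 'I_n]) (X i @^-1` B i)) =
    (\prod_(i < n) P (X i @^-1` B i))%E.

(* Z = (Z_k)_k is N(0, S) on R^K: characteristic function exp(-u^t S u / 2) *)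
Definition gaussian_vec d (T : measurableType d) (Q : probability T R)
  (K : nat) (S : 'M[R]_K) (Z : 'I_K -> T -> R) : Prop :=
  (forall k, measurable_fun setT (Z k)) /\
  forall u : 'rV[R]_K,
    ('E_Q[fun w => cos (\sum_(k < K) u 0 k * Z k w)] = (expR (- quadf S u / 2))%:E)%E /\
    ('E_Q[fun w => sin (\sum_(k < K) u 0 k * Z k w)] = 0)%E.

Definition cvg_dist (dn : nat -> measure_display) (Tn : forall n, measurableType (dn n))
  (P : forall n, probability (Tn n) R) (X : forall n, Tn n -> R)
  d (T : measurableType d) (Q : probability T R) (W : T -> R) : Prop :=
  forall h : R -> R, continuous h -> (exists M, forall x, `|h x| <= M) ->
    (fun n => 'E_(P n)[fun w => h (X n w)]) @ \oo --> 'E_Q[fun w => h (W w)].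

End defs.

(* Main.v *)
Require Import Defs.
From HB Require Import structures.
From mathcomp Require Import all_boot all_order all_algebra.
From mathcomp Require Import all_classical all_reals all_analysis.
From mathcomp Require Import measurable_realfun ring lra.
Set Implicit Arguments.
Unset Strict Implicit.
Unset Printing Implicit Defensive.
Import Order.TTheory GRing.Theory Num.Theory.
Import numFieldNormedType.Exports.
Local Open Scope classical_set_scope.
Local Open Scope ereal_scope.
Local Open Scope ring_scope.

(** The normalising constant cancels in the ratio of posterior masses. On a ball
    of radius [C / sqrt n] the prior density and the likelihood are constant up
    to factors tending to [1] (in probability for the likelihood), and the two
    balls have the same volume, so the log-ratio is
    [ln (f beta1 / f beta0) + logdiff (beta1 - beta0)] up to a vanishing error,
    where [logdiff] is the log-likelihood ratio with respect to [beta0]: a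
    linear form in the scores minus half the quadratic form of [X^t X / n].
    The linear form is a weighted sum of the errors; its characteristic function
    converges to the Gaussian one by a telescoping product estimate, and this
    gives convergence in distribution because a bounded continuous function is
    close to a trigonometric polynomial on a compact interval. *)

(** The posterior log-ratio is not shown to be measurable in the sample point, so the vanishing
    error is not handled as convergence in probability. For every [e] and all large [n] the error is
    at most [e * G n w] for every [w], where [G] is 1 plus the sum of the squared scores and has
    mean [1 + K] for large [n]. Expectations of functions of the log-ratio are then squeezed between
    integrable functions, and exceptional events are replaced by integrable weights in the manner of
    Markov and Chebyshev.

    In the Gaussian limit, the fourth moments make the error in each factor of the characteristic
    function of order [|a_i|^3]. The sum of these is at most the largest [|a_i|] times the sum of
    the [a_i^2], and so tends to 0.

    The trigonometric polynomial has to keep the bound of the test function off the compact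
    interval, since otherwise the tails would not be under control. This is why it is built from
    nonnegative Fejer weights that sum to 1. *)

(* The library integral is a supremum over simple functions, so the facts below
   need no measurability. This matters twice: for the inner integrands of [iint]
   and for the posterior log-ratio as a function of the sample point. *)
Section integral_without_measurability.
Context d (T : measurableType d) (R : realType).
Variable mu : {measure set T -> \bar R}.
Local Open Scope ereal_scope.
Import HBNNSimple.

Lemma integral_le (f g : T -> \bar R) : (forall x, f x <= g x) ->
  \int[mu]_x f x <= \int[mu]_x g x.
Proof.
move=> fg; rewrite /integral !patch_setT.
apply: leeB; apply: le_ereal_sup => _ [h /= hf <-]; exists h => // x;
  apply: (le_trans (hf x)).
- by rewrite !funeposE ge_max !le_max fg lexx orbT.
- by rewrite !funenegE ge_max !le_max leeN2 fg lexx orbT.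
Qed.

(** Scaling the simple functions below [g] by [a] gives one inequality. The converse is the same
    inequality for [c^-1] and [c * f]. *)
Lemma ge0_integral_scale (c : R) (f : T -> \bar R) : (0 <= c)%R ->
  (forall x, 0 <= f x) -> \int[mu]_x (c%:E * f x) = c%:E * \int[mu]_x f x.
Proof.
have key (a : R) (g : T -> \bar R) : (0 < a)%R -> (forall x, 0 <= g x) ->
    a%:E * \int[mu]_x g x <= \int[mu]_x (a%:E * g x).
  move=> a0 g0; have ag0 x : 0 <= a%:E * g x by rewrite mule_ge0// lee_fin ltW.
  rewrite !ge0_integralTE// -lee_pdivlMl//; apply: ge_ereal_sup => _ [h hg <-].
  rewrite lee_pdivlMl//; apply: ereal_sup_ubound.
  exists (scale_nnsfun h (ltW a0)) => [x|] /=.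
    by rewrite EFinM lee_pmul2l.
  by rewrite -sintegralrM; apply: eq_sintegral.
rewrite le_eqVlt => /predU1P[<-|c0] f0.
  by rewrite mul0e; apply: integral0_eq => x _; rewrite mul0e.
apply/eqP; rewrite eq_le key// andbT -lee_pdivrMl//.
have cf0 x : 0 <= c%:E * f x by rewrite mule_ge0// lee_fin ltW.
apply: (le_trans (key _ _ _ cf0)); first by rewrite invr_gt0.
by apply: integral_le => x; rewrite muleA -EFinM mulVf ?gt_eqF// mul1e.
Qed.

End integral_without_measurability.

(** * Translation invariance of the one-dimensional integral *)

Section lebesgue_translation.
Context (R : realType).
Notation mu := (@lebesgue_measure R).
Local Open Scope ereal_scope.
Import HBNNSimple.

(** Named so that it can carry the structure of a measurable function, for the pushforward of [mu]
    along it to be a measure. *)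
Definition translate (a : R) : measurableTypeR R -> measurableTypeR R :=
  fun x => (x + a)%R.

Lemma measurable_translate (a : R) : measurable_fun setT (translate a).
Proof. exact: measurable_funD. Qed.

HB.instance Definition _ (a : R) :=
  isMeasurableFun.Build _ _ _ _ (translate a) (measurable_translate a).

Lemma lebesgue_measure_translate (a : R) (A : set (measurableTypeR R)) :
  measurable A -> mu A = pushforward mu (translate a) A.
Proof.
apply: lebesgue_measure_unique => _ [[x y] _ <-] /=.
rewrite /pushforward (_ : _ @^-1` _ = `](x - a)%R, (y - a)%R]%classic).
  rewrite !lebesgue_measure_itv/= !lte_fin ltrD2r; case: ifPn => // _.
  by rewrite -!EFinD; congr EFin; lra.
by apply/seteqP; split => z /=; rewrite !in_itv/= /translate; lra.
Qed.

(** The change of variables is made for simple functions only, as [f] need not be measurable. It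
    gives one inequality for every shift; the shift by [- a] gives the converse. *)
Lemma ge0_integral_translate (a : R) (f : R -> \bar R) : (forall x, 0 <= f x) ->
  \int[mu]_x f (x + a)%R = \int[mu]_x f x.
Proof.
have key b (g : R -> \bar R) : (forall x, 0 <= g x) ->
    \int[mu]_x g x <= \int[mu]_x g (x + b)%R.
  move=> g0; rewrite [leLHS]ge0_integralTE//; apply: ge_ereal_sup => _ [h hg <-].
  apply: (@le_trans _ _ (\int[mu]_x (h (x + b)%R)%:E)); last first.
    by apply: integral_le => x; exact: hg.
  have -> : \int[mu]_x (h (x + b)%R)%:E = \int[pushforward mu (translate b)]_x (h x)%:E.
    rewrite (ge0_integral_pushforward (measurable_translate b))//=.
    - exact/measurable_EFinP/measurable_funP.
    - by move=> y _; rewrite lee_fin.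
  have -> // := @eq_measure_integral _ (measurableTypeR R) R setT mu
    (pushforward mu (translate b)) (fun x => (h x)%:E).
    by rewrite integral_nnsfun// patch_setT.
  by move=> A mA _; rewrite /= -lebesgue_measure_translate.
move=> f0; apply/eqP; rewrite eq_le key// andbT.
have := key (- a)%R (fun x => f (x + a)%R) (fun x => f0 _) => /le_trans; apply.
by apply: integral_le => x; rewrite subrK.
Qed.
End lebesgue_translation.

(** * The iterated integral over [R^K]: monotonicity, scaling, translation *)

Section iterated_integral.
Context (R : realType).
Notation mu := (@lebesgue_measure R).
Local Open Scope ereal_scope.

Lemma iint_ge0 (K : nat) (g : seq R -> \bar R) :
  (forall s, 0 <= g s) -> 0 <= iint K g.
Proof.
by elim: K g => //= K IH g g0; apply: integral_ge0 => t _; exact: IH.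
Qed.

Lemma iint_le (K : nat) (g h : seq R -> \bar R) :
  (forall s, size s = K -> g s <= h s) -> iint K g <= iint K h.
Proof.
elim: K g h => [|K IH] g h gh /=; first exact: gh.
by apply: integral_le => t; apply: IH => s sK; apply: gh; rewrite /= sK.
Qed.

Lemma eq_iint (K : nat) (g h : seq R -> \bar R) :
  (forall s, size s = K -> g s = h s) -> iint K g = iint K h.
Proof. by move=> gh; apply/eqP; rewrite eq_le !iint_le// => s /gh->. Qed.

Lemma iint_scale (K : nat) (c : R) (g : seq R -> \bar R) : (0 <= c)%R ->
  (forall s, 0 <= g s) -> iint K (fun s => c%:E * g s) = c%:E * iint K g.
Proof.
move=> c0; elim: K g => //= K IH g g0.
rewrite -ge0_integral_scale//; last by move=> t; exact: iint_ge0.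
by apply: eq_integral => t _; exact: IH.
Qed.

Lemma iint_translate (K : nat) (a : seq R) (g : seq R -> \bar R) :
  size a = K -> (forall s, 0 <= g s) ->
  iint K (fun s => g [seq (p.1 + p.2)%R | p <- zip s a]) = iint K g.
Proof.
elim: K a g => [|K IH] [|x a] g //= [aK] g0.
rewrite -[RHS](ge0_integral_translate x); last by move=> t; exact: iint_ge0.
apply: eq_integral => t _.
exact: (IH a (fun s => g ((t + x)%R :: s))).
Qed.

(** The only volume that is computed. An inscribed and a circumscribed cube show that the volume of
    a ball is positive and finite, and its value does not matter because it cancels. *)
Lemma iint_cube (K : nat) (r : R) : (0 < r)%R ->
  iint K (fun s => (\prod_(k < K) \1_(`[- r, r]%classic : set R) (nth 0 s k))%R%:E)
    = ((2 * r) ^+ K)%:E.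
Proof.
move=> r0; elim: K => [|K IH] /=; first by rewrite big_ord0.
transitivity (\int[mu]_t (((2 * r) ^+ K)%:E * (\1_(`[- r, r]%classic : set R) t)%:E)).
  apply: eq_integral => t _.
  rewrite muleC -IH -iint_scale//.
  - by apply: eq_iint => s _; rewrite big_ord_recl/= EFinM.
  - by move=> s; rewrite lee_fin prodr_ge0.
rewrite ge0_integral_scale; last 2 first.
- by rewrite exprn_ge0// mulr_ge0// ltW.
- by move=> x; rewrite lee_fin.
rewrite integral_indic// setIT.
rewrite [X in (_ * X)%E](_ : _ = mu `[(- r)%R, r]%classic)//.
rewrite lebesgue_measure_itv/= lte_fin ifT; last by lra.
by rewrite -EFinD -EFinM exprSr; congr EFin; congr (_ * _)%R; lra.
Qed.

Lemma leb_intK_le (K : nat) (g h : 'rV[R]_K -> \bar R) :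
  (forall v, g v <= h v) -> leb_intK g <= leb_intK h.
Proof. by move=> gh; apply: iint_le. Qed.

Lemma leb_intK_scale (K : nat) (c : R) (g : 'rV[R]_K -> \bar R) : (0 <= c)%R ->
  (forall v, 0 <= g v) -> leb_intK (fun v => c%:E * g v) = c%:E * leb_intK g.
Proof. by move=> c0 g0; rewrite /leb_intK iint_scale. Qed.

Lemma leb_intK_translate (K : nat) (a : 'rV[R]_K) (g : 'rV[R]_K -> \bar R) :
  (forall v, 0 <= g v) -> leb_intK (fun v => g (v + a)%R) = leb_intK g.
Proof.
move=> g0; pose A := [seq a 0%R k | k <- enum 'I_K].
have sA : size A = K by rewrite size_map size_enum_ord.
rewrite /leb_intK -[RHS](@iint_translate _ A)//.
apply: eq_iint => s sK; congr g; apply/rowP => k; rewrite !mxE.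
rewrite (nth_map (0, 0)%R); last by rewrite size_zip sK sA minnn.
rewrite nth_zip ?sK ?sA//=.
by rewrite /A (nth_map k) ?size_enum_ord// nth_ord_enum.
Qed.

End iterated_integral.

(** * Volume of Euclidean balls *)

Section euclidean_balls.
Context (R : realType) (K : nat).
Implicit Types u v : 'rV[R]_K.

Lemma dotv_ge0 v : 0 <= dotv v v.
Proof. by apply: sumr_ge0 => k _; rewrite -expr2 sqr_ge0. Qed.

Lemma coord_le_enorm v k : `|v 0 k| <= enorm v.
Proof.
rewrite -sqrtr_sqr ler_sqrt ?dotv_ge0// expr2 /dotv (bigD1 k)//= lerDl.
by apply: sumr_ge0 => j _; rewrite -expr2 sqr_ge0.
Qed.

Lemma enorm_le_sum v : enorm v <= \sum_(k < K) `|v 0 k|.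
Proof.
rewrite -[leRHS]ger0_norm ?sumr_ge0// -sqrtr_sqr ler_sqrt ?sqr_ge0//.
rewrite expr2 /dotv mulr_suml; apply: ler_sum => k _.
rewrite (le_trans (ler_norm _))// normrM ler_wpM2l//.
by rewrite (bigD1 k)//= lerDl sumr_ge0.
Qed.

Lemma leb_intK_eball (b : 'rV[R]_K) (r : R) :
  leb_intK (fun v => (\1_(eball b r) v)%:E) = leb_intK (fun v => (\1_(eball 0 r) v)%:E).
Proof.
rewrite -[LHS](leb_intK_translate b); last by move=> v; rewrite lee_fin.
congr leb_intK; apply/funext => v; rewrite !indicE; congr (_%:R%:E); congr nat_of_bool.
by apply/idP/idP; rewrite !inE /eball/= addrK subr0.
Qed.

Lemma leb_intK_eball_pos (b : 'rV[R]_K) (r : R) : 0 < r ->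
  exists2 V : R, 0 < V & leb_intK (fun v => (\1_(eball b r) v)%:E) = V%:E.
Proof.
move=> r0; rewrite leb_intK_eball.
have ub : (leb_intK (fun v => (\1_(eball 0 r) v)%:E) <= ((2 * r) ^+ K)%:E)%E.
  rewrite -iint_cube//; apply: iint_le => s _; rewrite lee_fin indicE.
  have [/set_mem sr|_] := boolP (_ \in _); last by rewrite prodr_ge0.
  rewrite big1// => k _; rewrite indicE mem_set//= in_itv/=.
  have := coord_le_enorm (\row_(k < K) nth 0 s k) k.
  move: sr; rewrite /eball/= subr0 mxE ler_norml => /ltW sr /andP[l1 l2].
  by rewrite (le_trans _ l1) ?lerN2//= (le_trans l2).
(* Half-side of the inscribed cube. With [K.+1] the norm is at most [K * (r / K.+1)], which is
   strictly less than [r], also for [K = 0]. *)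
have r'0 : 0 < r / K.+1%:R by rewrite divr_gt0.
have lb : (((2 * (r / K.+1%:R)) ^+ K)%:E <= leb_intK (fun v => (\1_(eball 0 r) v)%:E))%E.
  rewrite -iint_cube//; apply: iint_le => s _; rewrite lee_fin indicE.
  have [_|/negP sr] := boolP (_ \in eball 0 r).
    by apply: prodr_ile1 => k _; rewrite indicE ler0n lern1 leq_b1.
  have [k hk] : exists k : 'I_K, ~ (`[- (r / K.+1%:R), r / K.+1%:R]%classic : set R) (nth 0 s k).
    apply/existsNP => H; apply: sr; rewrite inE /eball/= subr0.
    apply: (le_lt_trans (enorm_le_sum _)).
    apply: (@le_lt_trans _ _ (\sum_(k < K) (r / K.+1%:R))).
      by apply: ler_sum => k _; rewrite mxE ler_norml; have := H k; rewrite /= in_itv.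
    rewrite sumr_const card_ord -[_ *+ K]mulr_natr mulrAC ltr_pdivrMr// ltr_pM2l//.
    by rewrite ltr_nat.
  by rewrite (bigD1 k)//= indicE memNset ?mul0r//.
have lb0 : (0 < leb_intK (fun v => (\1_(eball (0%R : 'rV[R]_K) r) v)%:E))%E.
  by apply: lt_le_trans lb; rewrite lte_fin exprn_gt0// mulr_gt0.
by case: (leb_intK _) ub lb0 => // V _ V0; exists V.
Qed.

End euclidean_balls.

(** * Posterior masses of small balls *)

Section posterior_of_balls.
Context (R : realType) (K : nat).
Variables (f L : 'rV[R]_K -> R).
Hypothesis f_gt0 : forall b, 0 < f b.
Hypothesis L_gt0 : forall b, 0 < L b.

(** On the ball the integrand stays within the factors [expR (- e)] and [expR e] of its value at the
    centre, so the integral lies between two multiples of the volume [V]. Comparison with multiples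
    of the indicator uses only monotonicity and scaling. *)
Lemma ball_mass (b0 : 'rV[R]_K) (r e V : R) : 0 < V ->
  leb_intK (fun v => (\1_(eball (0 : 'rV[R]_K) r) v)%:E) = V%:E ->
  (forall b, eball b0 r b -> `|ln (f b * L b) - ln (f b0 * L b0)| <= e) ->
  exists I : R, [/\ leb_intK (fun b => (\1_(eball b0 r) b * f b * L b)%:E) = I%:E,
    0 < I & `|ln I - (ln (f b0 * L b0) + ln V)| <= e].
Proof.
move=> V0 VE hb; have [m mE m0] : exists2 m, m = f b0 * L b0 & 0 < m.
  by exists (f b0 * L b0); rewrite ?mulr_gt0.
rewrite -mE in hb *.
have bnd b : eball b0 r b -> m * expR (- e) <= f b * L b <= m * expR e.
  move=> /hb; rewrite ler_norml => /andP[h1 h2].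
  have E y : m * expR y = expR (ln m + y) by rewrite expRD lnK ?posrE.
  have -> : f b * L b = expR (ln (f b * L b)) by rewrite lnK ?posrE ?mulr_gt0.
  by rewrite !E !ler_expR; apply/andP; split; lra.
have scl c : 0 <= c ->
    leb_intK (fun b => (c * \1_(eball b0 r) b)%:E) = (c * V)%:E.
  by move=> c0; rewrite EFinM -VE -(leb_intK_eball b0) -leb_intK_scale.
set J := leb_intK _.
have ub : (J <= (m * expR e * V)%:E)%E.
  rewrite -scl; last by rewrite mulr_ge0 ?expR_ge0 ?ltW.
  apply: leb_intK_le => b; rewrite lee_fin indicE.
  have [/set_mem/bnd/andP[_ h]|_] := boolP (b \in _); last by rewrite !mul0r mulr0.
  by rewrite mul1r mulr1.
have lb : ((m * expR (- e) * V)%:E <= J)%E.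
  rewrite -scl; last by rewrite mulr_ge0 ?expR_ge0 ?ltW.
  apply: leb_intK_le => b; rewrite lee_fin indicE.
  have [/set_mem/bnd/andP[h _]|_] := boolP (b \in _); last by rewrite !mul0r mulr0.
  by rewrite mul1r mulr1.
case: J ub lb => // I; rewrite !lee_fin => ub lb; exists I.
have I0 : 0 < I by apply: lt_le_trans lb; rewrite !mulr_gt0 ?expR_gt0.
split=> //; rewrite -ler_ln ?posrE ?mulr_gt0 ?expR_gt0// in ub.
rewrite -ler_ln ?posrE ?mulr_gt0 ?expR_gt0// in lb.
rewrite !lnM ?posrE ?mulr_gt0 ?expR_gt0// !expRK in ub lb.
by rewrite ler_norml; apply/andP; split; lra.
Qed.

Lemma ln_posterior_ratio (b1 b0 : 'rV[R]_K) (r e c : R) : 0 < r ->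
  leb_intK (fun b => (f b)%:E) = 1%E -> (forall b, L b <= c) ->
  (forall b, eball b1 r b -> `|ln (f b * L b) - ln (f b1 * L b1)| <= e) ->
  (forall b, eball b0 r b -> `|ln (f b * L b) - ln (f b0 * L b0)| <= e) ->
  `|ln (posterior f L (eball b1 r) / posterior f L (eball b0 r))
    - (ln (f b1 * L b1) - ln (f b0 * L b0))| <= 2 * e.
Proof.
move=> r0 f1 Lc h1 h0.
have [V V0 VE] := leb_intK_eball_pos (0 : 'rV[R]_K) r0.
have [I1 [I1E I10 I1e]] := ball_mass V0 VE h1.
have [I0 [I0E I00 I0e]] := ball_mass V0 VE h0.
(* The evidence must be finite and nonzero to cancel, since [fine] sends an infinite value to 0. It
   is at least the mass [I0] of one ball, and at most [c] because [f] integrates to 1. *)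
have [D D0 DE] : exists2 D : R, 0 < D & leb_intK (fun b => (f b * L b)%:E) = D%:E.
  have lb : (I0%:E <= leb_intK (fun b => (f b * L b)%:E))%E.
    rewrite -I0E; apply: leb_intK_le => b; rewrite lee_fin -mulrA indicE.
    by rewrite ler_piMl// ?lern1 ?leq_b1// mulr_ge0 ?ltW.
  have c0 : 0 <= c by apply: (le_trans _ (Lc b0)); exact: ltW.
  have ub : (leb_intK (fun b => (f b * L b)%:E) <= c%:E)%E.
    rewrite -[c%:E]mule1 -f1 -leb_intK_scale//.
      by apply: leb_intK_le => b; rewrite -EFinM lee_fin mulrC ler_pM2r.
    by move=> v; rewrite lee_fin ltW.
  case: (leb_intK _) lb ub => // D; rewrite lee_fin => lb _; exists D => //.
  exact: lt_le_trans lb.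
rewrite /posterior I1E I0E DE/=.
have -> : I1 / D / (I0 / D) = I1 / I0 by field; rewrite !gt_eqF.
rewrite ln_div ?posrE//; move: I1e I0e; rewrite !ler_norml => /andP[? ?] /andP[? ?].
by apply/andP; split; lra.
Qed.

End posterior_of_balls.

(** * Taylor bounds and uniform continuity *)

Section real_analysis_bounds.
Context (R : realType).

(** Generates the Taylor bounds one from another: the difference of the two sides of each bound
    vanishes at 0, and its derivative is the difference treated just before. *)
Lemma ge0_of_derive_ge0 (F dF : R -> R) : (forall x : R, is_derive x (1 : R) F (dF x)) ->
  F 0 = 0 -> (forall x, 0 <= x -> 0 <= dF x) -> forall x, 0 <= x -> 0 <= F x.
Proof.
move=> FdF F0 dF0 x x0.
have [|c] := @MVT_segment _ F dF 0 x x0 (fun y _ => FdF y).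
- apply: continuous_subspaceT => y.
  exact/differentiable_continuous/derivable1_diffP/ex_derive.
- rewrite in_itv/= => /andP[c0 _]; rewrite F0 !subr0 => ->.
  by rewrite mulr_ge0 ?dF0.
Qed.

Lemma sin_le_id (x : R) : 0 <= x -> sin x <= x.
Proof.
move=> x0; rewrite -subr_ge0; move: x x0.
apply: (@ge0_of_derive_ge0 (fun x => x - sin x) (fun x => 1 - cos x)).
- by rewrite sin0 subrr.
- by move=> x _; rewrite subr_ge0 cos_le1.
Qed.

Lemma cos_ge_quadratic (x : R) : 0 <= x -> 1 - x ^+ 2 / 2 <= cos x.
Proof.
move=> x0; rewrite -subr_ge0; move: x x0.
apply: (@ge0_of_derive_ge0 (fun x => cos x - (1 - x ^+ 2 / 2)) (fun x => x - sin x)).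
- move=> x; apply: is_derive_eq; rewrite /GRing.scale/=; by field.
- rewrite cos0; ring.
- by move=> x x0; rewrite subr_ge0 sin_le_id.
Qed.

Lemma sin_ge_cubic (x : R) : 0 <= x -> x - x ^+ 3 / 6 <= sin x.
Proof.
move=> x0; rewrite -subr_ge0; move: x x0.
apply: (@ge0_of_derive_ge0 (fun x => sin x - (x - x ^+ 3 / 6))
  (fun x => cos x - (1 - x ^+ 2 / 2))).
- move=> x; apply: is_derive_eq; rewrite /GRing.scale/=; by field.
- rewrite sin0; ring.
- by move=> x x0; rewrite subr_ge0 cos_ge_quadratic.
Qed.

Lemma cos_le_quartic (x : R) : 0 <= x -> cos x <= 1 - x ^+ 2 / 2 + x ^+ 4 / 24.
Proof.
move=> x0; rewrite -subr_ge0; move: x x0.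
apply: (@ge0_of_derive_ge0 (fun x => 1 - x ^+ 2 / 2 + x ^+ 4 / 24 - cos x)
  (fun x => sin x - (x - x ^+ 3 / 6))).
- move=> x; apply: is_derive_eq; rewrite /GRing.scale/=; by field.
- rewrite cos0; ring.
- by move=> x x0; rewrite subr_ge0 sin_ge_cubic.
Qed.

Lemma norm_sin_sub_id (x : R) : `|sin x - x| <= `|x| ^+ 3.
Proof.
wlog x0 : x / 0 <= x.
  move=> H; have [/H//|/ltW] := leP 0 x; rewrite -oppr_ge0 => /H.
  by rewrite sinN -opprD !normrN.
rewrite (ger0_norm x0) ler_norml; apply/andP; split.
  by have := sin_ge_cubic x0; have := exprn_ge0 3 x0; lra.
by have := sin_le_id x0; have := exprn_ge0 3 x0; lra.
Qed.

Lemma norm_cos_sub_quadratic (x : R) : `|cos x - (1 - x ^+ 2 / 2)| <= x ^+ 4.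
Proof.
wlog x0 : x / 0 <= x.
  move=> H; have [/H//|/ltW] := leP 0 x; rewrite -oppr_ge0 => /H.
  by rewrite cosN sqrrN (_ : (- x) ^+ 4 = x ^+ 4); last by ring.
rewrite ler_norml; have := cos_ge_quadratic x0; have := cos_le_quartic x0.
have := exprn_ge0 4 x0; move=> ? ? ?; apply/andP; split; lra.
Qed.

Lemma norm_expRN_sub_linear (y : R) : 0 <= y -> `|expR (- y) - (1 - y)| <= y ^+ 2.
Proof.
move=> y0; have y1 : 0 < 1 + y by lra.
have h1 := expR_ge1Dx (- y).
have h2 : expR (- y) <= (1 + y)^-1.
  by rewrite expRN lef_pV2 ?posrE ?expR_gt0// expR_ge1Dx.
have h3 : (1 + y)^-1 <= 1 - y + y ^+ 2.
  rewrite -[leLHS]mul1r ler_pdivrMr//.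
  by have := exprn_ge0 3 y0; rewrite (_ : (1 - y + y ^+ 2) * (1 + y) = 1 + y ^+ 3); [lra|ring].
rewrite ler_norml; apply/andP; split; lra.
Qed.

(** Only [x] is confined to the segment. In the uses below [y] is a node or a value of the log-ratio
    and may lie outside, so uniform continuity on the segment would not be enough. *)
Lemma continuous_unif_segment (h : R -> R) (A e : R) : continuous h -> 0 < e ->
  exists2 dl, 0 < dl & forall x y, `|x| <= A -> `|x - y| < dl -> `|h x - h y| < e.
Proof.
move=> hc e0.
pose P (dl x : R) := forall y, `|x - y| < dl -> `|h x - h y| < e.
have : \forall dl \near 0^'+, (`[- A, A]%classic : set R) `<=` P dl.
  have /compact_near_coveringP := @segment_compact R (- A) A.
  apply=> x _.
  have e20 : 0 < e / 2 by rewrite divr_gt0.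
  have /cvgrPdist_lt /(_ _ e20) := hc x.
  rewrite near_simpl => -[/= r r0 hr].
  have r20 : 0 < r / 2 by rewrite divr_gt0.
  exists (ball x (r / 2), [set t | t < r / 2]).
    split; first exact: nbhsx_ballx.
    exact: nbhs_right_lt.
  case=> x' t [/= xx' tr] y x'y.
  have h1 : `|h x - h x'| < e / 2.
    by apply: hr => /=; apply: (lt_le_trans xx'); lra.
  have h2 : `|h x - h y| < e / 2.
    apply: hr => /=; move: xx'; rewrite /ball/= => xx'.
    rewrite (_ : x - y = (x - x') + (x' - y)); last by ring.
    by rewrite (le_lt_trans (ler_normD _ _))//; lra.
  rewrite (_ : h x' - h y = - (h x - h x') + (h x - h y)); last by ring.
  by rewrite (le_lt_trans (ler_normD _ _))// normrN; lra.
move=> H; near (0 : R)^'+ => dl; exists dl; first by near: dl; exact: nbhs_right_gt.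
move=> x y xA; have : (`[- A, A]%classic : set R) `<=` P dl by near: dl.
by apply; rewrite /= in_itv/= -ler_norml.
Unshelve. all: by end_near. Qed.

End real_analysis_bounds.

(** * Approximation by trigonometric polynomials with Fejer weights *)

Section trigonometric_approximation.
Context (R : realType).

(** An inductive predicate, so that convergence of means extends from cosines and sines to all such
    functions by induction. Frequencies are arbitrary reals. *)
Inductive trig_poly : (R -> R) -> Prop :=
| trig_poly0 : trig_poly (fun=> 0)
| trig_poly_cos t : trig_poly (fun x => cos (t * x))
| trig_poly_sin t : trig_poly (fun x => sin (t * x))
| trig_polyD p q : trig_poly p -> trig_poly q -> trig_poly (fun x => p x + q x)
| trig_polyZ c p : trig_poly p -> trig_poly (fun x => c * p x).

Lemma trig_poly_sum (I : Type) (s : seq I) (F : I -> R -> R) :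
  (forall i, trig_poly (F i)) -> trig_poly (fun x => \sum_(i <- s) F i x).
Proof.
move=> FP; elim: s => [|i s IH].
  by rewrite (_ : (fun _ => _) = fun=> 0); [exact: trig_poly0|apply/funext => x; rewrite big_nil].
rewrite (_ : (fun _ => _) = (fun x => F i x + \sum_(j <- s) F j x)).
  exact: trig_polyD.
by apply/funext => x; rewrite big_cons.
Qed.

(* The squared modulus of the Dirichlet sum [\sum_(k < m) exp (i k x)], scaled so
   that its translates by the [m] nodes form a partition of unity. *)
Definition fejer (m : nat) (x : R) : R :=
  ((\sum_(k < m) cos (k%:R * x)) ^+ 2 + (\sum_(k < m) sin (k%:R * x)) ^+ 2) / m%:R ^+ 2.

Lemma fejer_ge0 m x : 0 <= fejer m x.
Proof. by rewrite divr_ge0 ?addr_ge0 ?sqr_ge0// exprn_ge0. Qed.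

Lemma fejerE m x :
  fejer m x = (\sum_(k < m) \sum_(l < m) cos ((k%:R - l%:R) * x)) / m%:R ^+ 2.
Proof.
rewrite /fejer !expr2 !big_distrlr/= -big_split/=; congr (_ / _).
apply: eq_bigr => k _; rewrite -big_split/=; apply: eq_bigr => l _.
by rewrite mulrBl cosB.
Qed.

(** Real part of the geometric sum of [exp (i k x)]: the factor [2 * sin (x / 2)] makes it
    telescope. The next lemma is the imaginary part. *)
Lemma dirichlet_cos (m : nat) (x : R) :
  2 * sin (x / 2) * (\sum_(k < m) cos (k%:R * x)) = sin (m%:R * x - x / 2) + sin (x / 2).
Proof.
elim: m => [|m IH]; first by rewrite big_ord0 mul0r sub0r sinN; ring.
rewrite big_ord_recr/= mulrDr IH.
rewrite (_ : m.+1%:R * x - x / 2 = m%:R * x + x / 2); last by rewrite -natr1; by field.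
rewrite (sinD (m%:R * x) (x / 2)) (sinB (m%:R * x) (x / 2)); ring.
Qed.

Lemma dirichlet_sin (m : nat) (x : R) :
  2 * sin (x / 2) * (\sum_(k < m) sin (k%:R * x)) = cos (x / 2) - cos (m%:R * x - x / 2).
Proof.
elim: m => [|m IH]; first by rewrite big_ord0 mul0r sub0r cosN; ring.
rewrite big_ord_recr/= mulrDr IH.
rewrite (_ : m.+1%:R * x - x / 2 = m%:R * x + x / 2); last by rewrite -natr1; by field.
rewrite (cosD (m%:R * x) (x / 2)) (cosB (m%:R * x) (x / 2)); ring.
Qed.

(** Multiplied by [2 * sin (x / 2)], the Dirichlet sum is a difference of two unit vectors, hence of
    length at most 2 whatever [m] is. *)
Lemma fejer_le m (x : R) : (0 < m)%N -> sin (x / 2) != 0 ->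
  fejer m x <= (m%:R ^+ 2 * sin (x / 2) ^+ 2)^-1.
Proof.
move=> m0 s0; rewrite invfM mulrC /fejer ler_pM2r; last first.
  by rewrite invr_gt0 exprn_gt0// ltr0n.
have s20 : 0 < sin (x / 2) ^+ 2 by rewrite exprn_even_gt0.
rewrite -[leRHS]mul1r ler_pdivlMr//.
set a := \sum_(k < m) cos _; set b := \sum_(k < m) sin _.
have Ha := dirichlet_cos m x; have Hb := dirichlet_sin m x; rewrite -/a -/b in Ha Hb.
have -> : (a ^+ 2 + b ^+ 2) * sin (x / 2) ^+ 2 =
   ((2 * sin (x / 2) * a) ^+ 2 + (2 * sin (x / 2) * b) ^+ 2) / 4 by field.
rewrite Ha Hb; move: (m%:R * x - x / 2) => u; move: (x / 2) => v.
have h1 := cos2Dsin2 u; have h2 := cos2Dsin2 v; have h3 := cos_geN1 (u + v).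
rewrite cosD in h3.
rewrite ler_pdivrMr// (_ : (sin u + sin v) ^+ 2 + (cos v - cos u) ^+ 2 =
  (cos u ^+ 2 + sin u ^+ 2) + (cos v ^+ 2 + sin v ^+ 2)
  - 2 * (cos u * cos v - sin u * sin v)); last by ring.
rewrite h1 h2; lra.
Qed.

(** The factor [2 * sin (th / 2)] telescopes the sum, and the two end terms agree because they
    differ by [d] full periods. The factor is positive since [0 < d < m] puts [th / 2] strictly
    between 0 and [pi]. *)
Lemma sum_cos_roots (m d : nat) (a : R) : (0 < d < m)%N ->
  \sum_(j < m) cos (a - d%:R * (2 * pi * j%:R / m%:R)) = 0.
Proof.
move=> /andP[d0 dm]; pose th : R := 2 * pi * d%:R / m%:R.
have m0 : (0 : R) < m%:R by rewrite ltr0n (leq_trans _ dm).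
have mn0 : (m%:R : R) != 0 by rewrite gt_eqF.
have s0 : 0 < sin (th / 2).
  rewrite sin_gt0_pi// /th (_ : _ / 2 = pi * (d%:R / m%:R)); last by field.
  have dm0 : (0 : R) < d%:R / m%:R by rewrite divr_gt0// ltr0n.
  have dm1 : d%:R / m%:R < 1 :> R by rewrite ltr_pdivrMr// mul1r ltr_nat.
  by have p0 := @pi_gt0 R; apply/andP; split; nra.
have tel n : 2 * sin (th / 2) * (\sum_(j < n) cos (a - j%:R * th)) =
    sin (a + th / 2) - sin (a - n%:R * th + th / 2).
  elim: n => [|n IH]; first by rewrite big_ord0 mul0r subr0; ring.
  rewrite big_ord_recr/= mulrDr IH.
  rewrite (_ : a - n.+1%:R * th + th / 2 = (a - n%:R * th) - th / 2); last by rewrite -natr1; by field.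
  rewrite (sinD (a - n%:R * th) (th / 2)) (sinB (a - n%:R * th) (th / 2)); ring.
have := tel m; rewrite (_ : a + th / 2 = (a - m%:R * th + th / 2) + (pi *+ 2) *+ d); last first.
  by rewrite -[(pi *+ 2) *+ d]mulr_natr -[pi *+ 2]mulr_natr /th; field.
rewrite (periodicn (@sinD2pi R)) subrr => /eqP.
rewrite mulf_eq0 gt_eqF ?mulr_gt0//= => /eqP H; rewrite -[RHS]H.
by apply: eq_bigr => j _; congr (cos (a - _)); rewrite /th; field.
Qed.

Definition fejer_node (m j : nat) : R := 2 * pi * j%:R / m%:R - pi.

Lemma fejer_node_bound m (j : 'I_m) : `|fejer_node m j| <= pi.
Proof.
have m0 : (0 : R) < m%:R by rewrite ltr0n (leq_ltn_trans _ (ltn_ord j)).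
have j0 : 0 <= j%:R / m%:R :> R by rewrite divr_ge0.
have j1 : j%:R / m%:R <= 1 :> R by rewrite ler_pdivrMr// mul1r ler_nat ltnW.
have p0 := @pi_gt0 R.
rewrite /fejer_node (_ : _ / _ = 2 * pi * (j%:R / m%:R)); last by rewrite !mulrA.
rewrite ler_norml; apply/andP; split; nra.
Qed.

(** Summation over the nodes kills every frequency [k - l] other than 0, as all of them are below
    [m] in absolute value. The [m] diagonal terms contribute [m] each, against the normalisation
    [m ^ 2]. *)
Lemma sum_fejer (m : nat) (x : R) : (0 < m)%N ->
  \sum_(j < m) fejer m (x - fejer_node m j) = 1.
Proof.
move=> m0; have mn0 : (m%:R : R) != 0 by rewrite pnatr_eq0 -lt0n.
under eq_bigr do rewrite fejerE.
rewrite -mulr_suml exchange_big/=.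
under eq_bigr do rewrite exchange_big/=.
have key (k l : 'I_m) : \sum_(j < m) cos ((k%:R - l%:R) * (x - fejer_node m j)) =
    (if l == k then m%:R else 0) :> R.
  have gt_case (k' l' : 'I_m) : (l' < k')%N ->
      \sum_(j < m) cos ((k'%:R - l'%:R) * (x - fejer_node m j)) = 0 :> R.
    move=> lk; rewrite -[RHS](@sum_cos_roots m (k' - l') ((k'%:R - l'%:R) * (x + pi))).
      apply: eq_bigr => j _; congr cos; rewrite natrB 1?ltnW// /fejer_node; ring.
    by rewrite subn_gt0 lk/= (leq_ltn_trans (leq_subr _ _) (ltn_ord k')).
  case: (ltngtP l k) => lk.
  - by rewrite ifF ?gt_case//; apply/eqP => E; rewrite E ltnn in lk.
  - rewrite ifF; last by apply/eqP => E; rewrite E ltnn in lk.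
    rewrite -[RHS](gt_case l k lk); apply: eq_bigr => j _.
    by rewrite -cosN -mulNr opprB.
  - have -> : l = k by apply/val_inj.
    rewrite eqxx; under eq_bigr do rewrite subrr mul0r cos0.
    by rewrite sumr_const card_ord.
under eq_bigr do under eq_bigr do rewrite key.
under eq_bigr do rewrite -big_mkcond/= big_pred1_eq.
by rewrite sumr_const card_ord -[_ *+ m]mulr_natr -expr2 divff// expf_eq0.
Qed.

Lemma trig_poly_fejer (m : nat) (c y : R) : trig_poly (fun x => fejer m (c * x - y)).
Proof.
rewrite (_ : (fun _ => _) = (fun x => (m%:R ^+ 2)^-1 * \sum_(k < m) \sum_(l < m)
   (cos ((k%:R - l%:R) * y) * cos ((k%:R - l%:R) * c * x)
     + sin ((k%:R - l%:R) * y) * sin ((k%:R - l%:R) * c * x)))).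
  apply: trig_polyZ; apply: trig_poly_sum => k; apply: trig_poly_sum => l.
  by apply: trig_polyD; apply: trig_polyZ; constructor.
apply/funext => x; rewrite fejerE mulrC; congr (_ * _).
apply: eq_bigr => k _; apply: eq_bigr => l _.
by rewrite mulrBr mulrA cosB; ring.
Qed.

(** [p] is a weighted average of samples of [h], with nonnegative weights summing to 1. It therefore
    inherits the bound [B] on the whole line. On the segment, nodes near the point contribute little
    by continuity and far nodes have small weight. *)
Lemma trig_approx (h : R -> R) (B L e : R) : continuous h ->
  (forall x, `|h x| <= B) -> 0 < L -> 0 < e ->
  exists p, [/\ trig_poly p, forall x, `|p x| <= B &
    forall x, `|x| <= L -> `|h x - p x| <= e].
Proof.
move=> hc hB L0 e0; have Ln0 : L != 0 by rewrite gt_eqF.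
have e20 : 0 < e / 2 by rewrite divr_gt0.
(* Rescaling moves the segment to [[-1, 1]], well inside the period [[-pi, pi]]. A point is then at
   distance at most [pi + 1 < 2 * pi] from each node, so [sin] of half the distance is small only
   close to the node. *)
pose g x := h (L * x).
have gc : continuous g.
  move=> x; apply: continuous_comp; last exact: hc.
  by apply: cvgM; [exact: cvg_cst|exact: cvg_id].
have B0 : 0 <= B by rewrite (le_trans _ (hB 0)).
have [dl' dl'0 gdl'] := continuous_unif_segment 1 gc e20.
(* The cap at 1 keeps the segment from [dl / 2] to [(pi + 1) / 2] nonempty. *)
pose dl := Num.min dl' 1.
have dl0 : 0 < dl by rewrite lt_min dl'0 ltr01.
have dl1 : dl <= 1 by rewrite ge_min lexx orbT.
have gdl x y : `|x| <= 1 -> `|x - y| < dl -> `|g x - g y| < e / 2.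
  by move=> x1 xy; apply: gdl' => //; apply: (lt_le_trans xy); rewrite ge_min lexx.
have p2 := @pi_ge2 R.
have [|c] := @EVT_min R sin (dl / 2) ((pi + 1) / 2) _ (continuous_subspaceT (@continuous_sin R)).
  by lra.
rewrite in_itv/= => /andP[c1 c2] cmin.
pose s := sin c; have s0 : 0 < s by apply: sin_gt0_pi; lra.
(* The at most [m] far nodes contribute at most [2 * B / (m ^ 2 * s ^ 2)] each, which this choice of
   [m] makes at most [e / 2] in total. *)
pose m := (Num.truncn (4 * B / (s ^+ 2 * e))).+1.
have m0 : (0 < m)%N by [].
have mR0 : (0 : R) < m%:R by rewrite ltr0n.
have mB : 4 * B <= m%:R * (s ^+ 2 * e).
  by rewrite -ler_pdivrMr ?mulr_gt0 ?exprn_gt0// ltW// /m truncnS_gt.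
exists (fun x => \sum_(j < m) g (fejer_node m j) * fejer m (L^-1 * x - fejer_node m j)).
split.
- by apply: trig_poly_sum => j; apply: trig_polyZ; exact: trig_poly_fejer.
- move=> x; rewrite (le_trans (ler_norm_sum _ _ _))//.
  rewrite -[leRHS]mulr1 -(sum_fejer (L^-1 * x) m0) mulr_sumr; apply: ler_sum => j _.
  rewrite normrM (ger0_norm (fejer_ge0 _ _)).
  by apply: ler_wpM2r; [exact: fejer_ge0|exact: hB].
move=> x xL; set z := L^-1 * x.
have z1 : `|z| <= 1 by rewrite normrM gtr0_norm ?invr_gt0// mulrC ler_pdivrMr// mul1r.
have -> : h x = g z by rewrite /g /z mulrA mulfV// mul1r.
rewrite -[g z]mulr1 -(sum_fejer z m0) mulr_sumr -sumrB.
apply: (le_trans (ler_norm_sum _ _ _)).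
apply: (@le_trans _ _ (\sum_(j < m) (e / 2 * fejer m (z - fejer_node m j) +
   2 * B * (m%:R ^+ 2 * s ^+ 2)^-1))).
  apply: ler_sum => j _; rewrite -mulrBl normrM (ger0_norm (fejer_ge0 _ _)).
  have c0 : 0 <= 2 * B * (m%:R ^+ 2 * s ^+ 2)^-1.
    by rewrite mulr_ge0 ?mulr_ge0// invr_ge0 mulr_ge0// sqr_ge0.
  have [zy|zy] := ltP `|z - fejer_node m j| dl.
    by rewrite (@le_trans _ _ (e / 2 * fejer m (z - fejer_node m j))) ?lerDl//
       ler_wpM2r ?fejer_ge0// ltW// gdl.
  apply: (@le_trans _ _ (2 * B * (m%:R ^+ 2 * s ^+ 2)^-1)); last first.
    by rewrite lerDr mulr_ge0 ?fejer_ge0// ltW.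
  have yb := fejer_node_bound j.
  have zy2 : `|z - fejer_node m j| <= pi + 1.
    by rewrite (le_trans (ler_normB _ _))//; lra.
  have sq : sin ((z - fejer_node m j) / 2) ^+ 2 = sin (`|z - fejer_node m j| / 2) ^+ 2.
    have [_|_] := ger0P (z - fejer_node m j); first by [].
    by rewrite mulNr sinN sqrrN.
  have sle : s <= sin (`|z - fejer_node m j| / 2).
    by apply: cmin; rewrite in_itv/=; apply/andP; split; lra.
  have sgt : 0 < sin (`|z - fejer_node m j| / 2) by exact: lt_le_trans sle.
  apply: ler_pM; rewrite ?fejer_ge0//.
    by rewrite (le_trans (ler_normB _ _))// mulr_natl mulr2n lerD// /g.
  apply: (le_trans (fejer_le m0 _)).
    by rewrite -sqrf_eq0 sq sqrf_eq0 gt_eqF.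
  rewrite sq lef_pV2 ?posrE ?mulr_gt0 ?exprn_gt0//.
  by rewrite ler_pM2l ?exprn_gt0// lerXn2r ?nnegrE// ltW.
rewrite big_split/= -mulr_sumr sum_fejer// sumr_const card_ord mulr1.
rewrite -[_ *+ m]mulr_natr.
have -> : 2 * B * (m%:R ^+ 2 * s ^+ 2)^-1 * m%:R = (4 * B) / (m%:R * s ^+ 2) / 2.
  by field; rewrite !gt_eqF.
have : 4 * B / (m%:R * s ^+ 2) <= e by rewrite ler_pdivrMr ?mulr_gt0 ?exprn_gt0//; nra.
lra.
Qed.

End trigonometric_approximation.

(** * Real-valued expectations *)

Section mean.
Context d (T : measurableType d) (R : realType) (P : probability T R).
Implicit Types (X Y : T -> R).

Definition mean X : R := \int[P]_w X w.
Definition itg X : Prop := P.-integrable setT (EFin \o X).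

Lemma mean_fine X : mean X = fine 'E_P[X].
Proof. by rewrite unlock. Qed.

Lemma expectation_mean X : itg X -> 'E_P[X] = (mean X)%:E.
Proof. by move=> iX; rewrite mean_fine unlock fineK// integrable_fin_num. Qed.

Lemma itg_dom X Y : measurable_fun setT X -> (forall w, `|X w| <= Y w) -> itg Y -> itg X.
Proof.
move=> mX XY; apply: le_integrable => //; first exact/measurable_EFinP.
by move=> w _; rewrite /= lee_fin (le_trans (XY w))// ler_norm.
Qed.

Lemma itg_cst c : itg (fun=> c).
Proof.
have := finite_measure_integrable_cst P c => /(_ setT) H.
by apply: H; exact: measurableT.
Qed.

Lemma itg_bounded X (B : R) : measurable_fun setT X -> (forall w, `|X w| <= B) -> itg X.
Proof. by move=> mX XB; apply: (itg_dom mX XB); exact: itg_cst. Qed.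

Lemma itgD X Y : itg X -> itg Y -> itg (fun w => X w + Y w).
Proof. by move=> iX iY; apply: (eq_integrable _ _ _ _ (integrableD _ iX iY)). Qed.

Lemma itgZ c X : itg X -> itg (fun w => c * X w).
Proof. by move=> iX; apply: (eq_integrable _ _ _ _ (integrableZl _ c iX)). Qed.

Lemma meanD X Y : itg X -> itg Y -> mean (fun w => X w + Y w) = mean X + mean Y.
Proof. by move=> iX iY; rewrite /mean RintegralD. Qed.

Lemma meanZ c X : itg X -> mean (fun w => c * X w) = c * mean X.
Proof. by move=> iX; rewrite /mean RintegralZl. Qed.

Lemma mean_cst c : mean (fun=> c) = c.
Proof. by have := expectation_cst P c; rewrite mean_fine => ->. Qed.

Lemma itgB X Y : itg X -> itg Y -> itg (fun w => X w - Y w).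
Proof.
move=> iX /(itgZ (-1)) iY; rewrite (_ : (fun _ => _) = fun w => X w + (-1) * Y w).
  exact: itgD.
by apply/funext => w; rewrite mulN1r.
Qed.

Lemma meanB X Y : itg X -> itg Y -> mean (fun w => X w - Y w) = mean X - mean Y.
Proof. by move=> iX iY; rewrite /mean RintegralB. Qed.

Lemma itg_sum (I : Type) (s : seq I) (Q : pred I) (F : I -> T -> R) :
  (forall i, itg (F i)) -> itg (fun w => \sum_(i <- s | Q i) F i w).
Proof.
move=> iF; elim: s => [|i s IH].
  by rewrite (_ : (fun _ => _) = fun=> 0); [exact: itg_cst|apply/funext => w; rewrite big_nil].
rewrite (_ : (fun _ => _) = fun w => (Q i)%:R * F i w + \sum_(i <- s | Q i) F i w).
  by apply: itgD => //; apply: itgZ.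
by apply/funext => w; rewrite big_cons; case: (Q i); rewrite ?mul1r// mul0r add0r.
Qed.

Lemma mean_sum (I : Type) (s : seq I) (Q : pred I) (F : I -> T -> R) :
  (forall i, itg (F i)) ->
  mean (fun w => \sum_(i <- s | Q i) F i w) = \sum_(i <- s | Q i) mean (F i).
Proof.
move=> iF; elim: s => [|i s IH].
  rewrite big_nil (_ : (fun _ => _) = fun=> 0) ?mean_cst//.
  by apply/funext => w; rewrite big_nil.
rewrite (_ : (fun _ => _) = fun w => (Q i)%:R * F i w + \sum_(i <- s | Q i) F i w).
  rewrite meanD ?meanZ//; [|exact: itgZ|exact: itg_sum].
  by rewrite IH big_cons; case: (Q i); rewrite ?mul1r// mul0r add0r.
by apply/funext => w; rewrite big_cons; case: (Q i); rewrite ?mul1r// mul0r add0r.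
Qed.

Lemma mean_le X Y : itg X -> itg Y -> (forall w, X w <= Y w) -> mean X <= mean Y.
Proof. by move=> iX iY XY; apply: le_Rintegral. Qed.

Lemma mean_ge0 X : (forall w, 0 <= X w) -> 0 <= mean X.
Proof. by move=> X0; apply: Rintegral_ge0. Qed.

Lemma norm_mean_le X Y : itg X -> itg Y -> (forall w, `|X w| <= Y w) ->
  `|mean X| <= mean Y.
Proof.
move=> iX iY XY; apply: (le_trans (le_normr_Rintegral _ iX)) => //.
apply: mean_le => //; exact: integrable_norm iX.
Qed.

Lemma norm_mean_bounded X (B : R) : measurable_fun setT X -> (forall w, `|X w| <= B) ->
  `|mean X| <= B.
Proof.
move=> mX XB; rewrite -(mean_cst B).
by apply: norm_mean_le => //; [exact: itg_bounded XB|exact: itg_cst].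
Qed.

Lemma mean_indic (A : set T) : measurable A -> (mean \1_A)%:E = P A.
Proof.
move=> mA; rewrite -expectation_mean ?expectation_indic//.
exact: integrable_indic.
Qed.

Lemma mean_dominated (F : nat -> T -> R) (f g : T -> R) :
  (forall n, measurable_fun setT (F n)) -> measurable_fun setT f ->
  (forall w, F ^~ w @ \oo --> f w) -> (forall n w, `|F n w| <= g w) -> itg g ->
  (fun n => mean (F n)) @ \oo --> mean f.
Proof.
move=> mF mf Ff Fg ig.
have fg w : `|f w| <= g w.
  by apply: (cvgr_to_le (cvg_norm (Ff w))); apply: nearW => n; exact: Fg.
have if_ : itg f by exact: itg_dom ig.
apply: (@fine_cvg _ _ _ _ (fun n => \int[P]_w (F n w)%:E)%E).
have -> : (mean f)%:E = (\int[P]_w (f w)%:E)%E.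
  by rewrite -expectation_mean// unlock.
apply: (@dominated_cvg _ _ _ P setT measurableT (fun n => EFin \o F n) (EFin \o f) (EFin \o g)) => //.
- by move=> n; exact/measurable_EFinP.
- by move=> w _; apply: cvg_EFin; [exact: nearW|exact: Ff].
- by move=> n w _; rewrite lee_fin Fg.
Qed.

End mean.

(** * Bounded measurable functions, and extension of product rules from indicators *)

Section independence.
Context d (T : measurableType d) (R : realType) (P : probability T R).

(** A class stable under sums, products and composition with a random variable. On a probability
    space its members are integrable, so linearity of [mean] applies to them without further
    conditions. *)
Definition bmeas d' (U : measurableType d') (g : U -> R) : Prop :=
  measurable_fun setT g /\ exists B : R, forall x, `|g x| <= B.

Lemma bmeas_cst d' (U : measurableType d') (c : R) : bmeas (fun _ : U => c).
Proof. by split; [exact: measurable_cst|exists `|c|]. Qed.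

Lemma bmeas_indic d' (U : measurableType d') (A : set U) : measurable A -> bmeas (\1_A : U -> R).
Proof.
move=> mA; split; first exact: measurable_indic.
by exists 1 => x; rewrite indicE ger0_norm// lern1 leq_b1.
Qed.

Lemma bmeasD d' (U : measurableType d') (g h : U -> R) :
  bmeas g -> bmeas h -> bmeas (fun x => g x + h x).
Proof.
move=> [mg [B gB]] [mh [C hC]]; split; first exact: measurable_funD.
by exists (B + C) => x; rewrite (le_trans (ler_normD _ _))// lerD.
Qed.

Lemma bmeasM d' (U : measurableType d') (g h : U -> R) :
  bmeas g -> bmeas h -> bmeas (fun x => g x * h x).
Proof.
move=> [mg [B gB]] [mh [C hC]]; split; first exact: measurable_funM.
by exists (B * C) => x; rewrite normrM ler_pM.
Qed.

Lemma bmeas_prod d' (U : measurableType d') (I : Type) (s : seq I) (Q : pred I) (F : I -> U -> R) :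
  (forall i, bmeas (F i)) -> bmeas (fun x => \prod_(i <- s | Q i) F i x).
Proof.
move=> bF; elim: s => [|i s IH].
  by under eq_fun do rewrite big_nil; exact: bmeas_cst.
under eq_fun do rewrite big_cons.
by case: (Q i) => //; exact: bmeasM.
Qed.

Lemma bmeas_sum d' (U : measurableType d') (I : Type) (s : seq I) (F : I -> U -> R) :
  (forall i, bmeas (F i)) -> bmeas (fun x => \sum_(i <- s) F i x).
Proof.
move=> bF; elim: s => [|i s IH].
  by under eq_fun do rewrite big_nil; exact: bmeas_cst.
by under eq_fun do rewrite big_cons; exact: bmeasD.
Qed.

Lemma measurable_fun_bigsum (I : Type) (s : seq I) (Q : pred I) (F : I -> T -> R) :
  (forall i, measurable_fun setT (F i)) ->
  measurable_fun setT (fun w => \sum_(i <- s | Q i) F i w).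
Proof.
move=> mF; elim: s => [|i s IH]; first by under eq_fun do rewrite big_nil; exact: measurable_cst.
under eq_fun do rewrite big_cons.
by case: (Q i) => //; exact: measurable_funD.
Qed.

Lemma bmeas_comp (g : R -> R) (Y : T -> R) : measurable_fun setT Y -> bmeas g ->
  bmeas (fun w => g (Y w)).
Proof.
move=> mY [mg [B gB]]; split; last by exists B.
exact: measurableT_comp.
Qed.

Lemma bmeas_itg (X : T -> R) : bmeas X -> itg P X.
Proof. by move=> [mX [B XB]]; exact: itg_bounded XB. Qed.

(** The sum counts the positive integers not exceeding [x], so it is the floor of [x]. *)
Lemma sum_indic_floor (m : nat) (x : R) : 0 <= x -> x < m%:R ->
  `|x - \sum_(j < m) \1_[set y : R | j.+1%:R <= y] x| <= 1.
Proof.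
elim: m x => [|m IH] x x0 xm; first by move: (le_lt_trans x0 xm); rewrite ltxx.
have [x1|x1] := leP 1 x.
  have := IH (x - 1); rewrite subr_ge0 x1 ltrBlDr natr1 xm => /(_ isT isT) H.
  rewrite big_ord_recl/= indicE mem_set//.
  rewrite (eq_bigr (fun j : 'I_m => \1_[set y : R | j.+1%:R <= y] (x - 1))).
    by rewrite opprD addrA.
  move=> j _; rewrite !indicE; congr (_%:R); congr nat_of_bool.
  by apply/idP/idP; rewrite !inE/= /bump/= add1n lerBrDr natr1.
rewrite big1 => [|j _]; first by rewrite subr0 ger0_norm// ltW.
rewrite indicE memNset//= => jx; have := lt_le_trans x1 (_ : 1 <= j.+1%:R).
rewrite ler1n => /(_ isT); lra.
Qed.

Lemma le_eps_scale_eq (a b c : R) : 0 <= c ->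
  (forall n : nat, `|a - b| <= c / n.+1%:R) -> a = b.
Proof.
move=> c0 H; apply/eqP; rewrite -subr_eq0 -normr_le0.
have [//|ab] := leP `|a - b| 0.
pose n := Num.truncn (c / `|a - b|).
have := H n; rewrite ler_pdivlMr// => Hn.
have : c / `|a - b| < n.+1%:R by rewrite truncnS_gt.
by rewrite ltr_pdivrMr// mulrC ltNge Hn.
Qed.

(* A bounded function is uniformly close to a combination of indicators of its
   superlevel sets, so a product rule for indicators extends to it. *)
Lemma mean_mul_of_indic (Y G : T -> R) (c : R) : measurable_fun setT Y -> bmeas G ->
  (forall B, measurable B ->
    mean P (fun w => \1_B (Y w) * G w) = mean P (fun w => \1_B (Y w)) * c) ->
  forall phi, bmeas phi ->
    mean P (fun w => phi (Y w) * G w) = mean P (fun w => phi (Y w)) * c.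
Proof.
move=> mY bG ind phi bphi; have [mphi [B phiB]] := bphi; have [mG [C GC]] := bG.
have t0 : T by exact: point.
have B0 : 0 <= B by apply: le_trans (phiB 0).
have C0 : 0 <= C by apply: le_trans (GC t0).
apply: (@le_eps_scale_eq _ _ (C + `|c|)) => [|n]; first by rewrite addr_ge0.
have n0 : (0 : R) < n.+1%:R by rewrite ltr0n.
(* Enough levels for [n.+1 * (phi + B)], which lies between 0 and [n.+1 * (2 * B)], to stay below
   [m]. *)
pose m := (Num.truncn (n.+1%:R * (2 * B))).+1.
pose S (j : nat) := [set y : R | j.+1%:R <= n.+1%:R * (phi y + B)].
have mS j : measurable (S j).
  have mf : measurable_fun setT (fun y => n.+1%:R * (phi y + B)).
    by apply: measurable_funM => //; exact: measurable_funD.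
  have := mf measurableT _ (measurable_itv `[j.+1%:R, +oo[); rewrite setTI.
  by congr measurable; apply/seteqP; split => y; rewrite /S /= in_itv/= andbT.
(* The shift by [B] is written with [\1_setT], so that [psi] is a combination of indicators
   throughout and [ind] applies to every term. *)
pose psi y := n.+1%:R^-1 * \sum_(j < m) \1_(S j) y - B * \1_setT y.
have psiE y : `|phi y - psi y| <= n.+1%:R^-1.
  have := phiB y; rewrite ler_norml => /andP[p1 p2].
  have h0 : 0 <= n.+1%:R * (phi y + B) by rewrite mulr_ge0// -lerBlDr sub0r.
  have hm : n.+1%:R * (phi y + B) < m%:R.
    by rewrite (le_lt_trans _ (truncnS_gt _))// ler_pM2l//; lra.
  have := sum_indic_floor h0 hm; rewrite /psi indicT mulr1.
  set s := \sum_(j < m) _.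
  have -> : phi y - (n.+1%:R^-1 * s - B) = n.+1%:R^-1 * (n.+1%:R * (phi y + B) - s).
    by field; rewrite gt_eqF.
  by move=> H; rewrite normrM gtr0_norm ?invr_gt0// ler_piMr.
have bI j : bmeas (fun w => \1_(S j) (Y w)) by apply: bmeas_comp => //; exact: bmeas_indic.
have bT : bmeas (fun w => \1_(setT : set R) (Y w)) by apply: bmeas_comp => //; exact: bmeas_indic.
have psiM : mean P (fun w => psi (Y w) * G w) = mean P (fun w => psi (Y w)) * c.
  have -> : (fun w => psi (Y w) * G w) = (fun w =>
      n.+1%:R^-1 * (\sum_(j < m) (\1_(S j) (Y w) * G w)) + (- B) * (\1_setT (Y w) * G w)).
    by apply/funext => w; rewrite /psi -mulr_suml; ring.
  have -> : (fun w => psi (Y w)) = (fun w =>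
      n.+1%:R^-1 * (\sum_(j < m) \1_(S j) (Y w)) + (- B) * \1_setT (Y w)).
    by apply/funext => w; rewrite /psi; ring.
  have iG j : itg P (fun w => \1_(S j) (Y w) * G w) by apply: bmeas_itg; exact: bmeasM.
  have iS j : itg P (fun w => \1_(S j) (Y w)) by exact: bmeas_itg.
  have iT : itg P (fun w => \1_(setT : set R) (Y w)) by exact: bmeas_itg.
  have iTG : itg P (fun w => \1_(setT : set R) (Y w) * G w) by apply: bmeas_itg; exact: bmeasM.
  have iGs := @itg_sum _ _ _ P _ (index_enum 'I_m) xpredT _ (fun j : 'I_m => iG j).
  have iSs := @itg_sum _ _ _ P _ (index_enum 'I_m) xpredT _ (fun j : 'I_m => iS j).
  rewrite !meanD ?meanZ ?mean_sum//; try exact: itgZ.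
  rewrite (ind setT)// mulrDl -!mulrA mulr_suml; congr (_ * _ + _).
  by apply: eq_bigr => j _; exact: ind.
have bpsi : bmeas (fun w => psi (Y w)).
  rewrite /psi; under eq_fun do rewrite -mulNr.
  apply: bmeasD; apply: bmeasM; try exact: bmeas_cst; last exact: bT.
  exact: (@bmeas_sum _ _ _ _ (fun (j : 'I_m) w => \1_(S j) (Y w))).
have bphiY : bmeas (fun w => phi (Y w)) by exact: bmeas_comp.
have -> : mean P (fun w => phi (Y w) * G w) - mean P (fun w => phi (Y w)) * c =
    mean P (fun w => (phi (Y w) - psi (Y w)) * G w)
    - mean P (fun w => phi (Y w) - psi (Y w)) * c.
  rewrite meanB; [|exact: bmeas_itg..].
  under [X in _ = X - _]eq_Rintegral do rewrite mulrBl.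
  rewrite -/(mean P _) meanB; [|by apply: bmeas_itg; exact: bmeasM..].
  by rewrite psiM; ring.
have mD : measurable_fun setT (fun w => phi (Y w) - psi (Y w)).
  by apply: measurable_funB; [case: bphiY|case: bpsi].
rewrite (le_trans (ler_normB _ _))// mulrDl lerD//.
  apply: norm_mean_bounded; first by apply: measurable_funM.
  by move=> w; rewrite normrM mulrC ler_pM.
rewrite normrM mulrC ler_wpM2l//; exact: norm_mean_bounded.
Qed.

End independence.

(** * Independent families: product rules and characteristic functions of sums *)

Section independent_family.
Context d (T : measurableType d) (R : realType) (P : probability T R).
Variables (n : nat) (X : 'I_n -> T -> R).
Hypothesis mX : forall i, measurable_fun setT (X i).
Hypothesis indX : mutually_independent P X.

(** Induction on the number [k] of leading factors that may be arbitrary while the others are still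
    indicators. With none it is the definition of independence. Each step frees one factor, the
    product of the others playing the part of [G] in [mean_mul_of_indic]. *)
Lemma mean_prod_indep (g : 'I_n -> R -> R) : (forall i, bmeas (g i)) ->
  mean P (fun w => \prod_(i < n) g i (X i w)) = \prod_(i < n) mean P (fun w => g i (X i w)).
Proof.
move=> bg.
suff H (k : nat) : forall g : 'I_n -> R -> R, (forall i, bmeas (g i)) ->
    (forall i : 'I_n, (k <= i)%N -> exists2 B : set R, measurable B & g i = \1_B) ->
    mean P (fun w => \prod_(i < n) g i (X i w)) = \prod_(i < n) mean P (fun w => g i (X i w)).
  by apply: (H n) => // i; rewrite leqNgt ltn_ord.
elim: k => [|k IH] {bg}{}g bg gI.
  have /choice[B BP] : forall i, exists B, measurable B /\ g i = \1_B.
    by move=> i; have [B mB gB] := gI i (leq0n _); exists B.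
  have mXB i : measurable (X i @^-1` B i).
    by rewrite -[X in measurable X]setTI; apply: mX => //; case: (BP i).
  apply: EFin_inj.
  have -> : (fun w => \prod_(i < n) g i (X i w)) =
      \1_(\bigcap_(i in [set: 'I_n]) (X i @^-1` B i)).
    apply/funext => w; rewrite indicE.
    have [/set_mem wB|/negP wB] := boolP (w \in _).
      apply: big1 => i _; rewrite (BP i).2 indicE mem_set//; exact: wB.
    have [i iB] : exists i, ~ B i (X i w).
      by apply/existsNP => H; apply: wB; rewrite inE => i _; exact: H.
    by rewrite (bigD1 i)//= (BP i).2 indicE memNset// mul0r.
  rewrite mean_indic; last first.
    by apply: fin_bigcap_measurable => //; exact: finite_finset.
  rewrite indX; last by move=> i; case: (BP i).
  rewrite -prodEFin; apply: eq_bigr => i _; rewrite -mean_indic//.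
  by congr (EFin (mean _ _)); apply/funext => w; rewrite (BP i).2.
have [kn|nk] := ltnP k n; last first.
  by apply: IH => // i ki; have := leq_trans nk ki; rewrite leqNgt ltn_ord.
pose i0 := Ordinal kn.
pose G w := \prod_(i < n | i != i0) g i (X i w).
pose c := \prod_(i < n | i != i0) mean P (fun w => g i (X i w)).
rewrite (bigD1 i0)//= -/c.
under [LHS]eq_Rintegral do rewrite (bigD1 i0)//=.
apply: (@mean_mul_of_indic _ _ _ P (X i0) G c) => //.
  by apply: bmeas_prod => i; exact: bmeas_comp.
move=> B mB; pose g' (i : 'I_n) : R -> R := if i == i0 then \1_B else g i.
have g'0 : g' i0 = \1_B by rewrite /g' eqxx.
have g'E i : i != i0 -> g' i = g i by move=> /negbTE ii0; rewrite /g' ii0.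
transitivity (mean P (fun w => \prod_(i < n) g' i (X i w))).
  congr mean; apply/funext => w; rewrite [RHS](bigD1 i0)//= g'0; congr (_ * _).
  by apply: eq_bigr => i /g'E ->.
rewrite IH; first 1 last.
- by move=> i; rewrite /g'; case: eqP => // _; exact: bmeas_indic.
- move=> i ki; rewrite /g'; case: eqP => [_|/eqP ii0]; first by exists B.
  apply: gI; rewrite ltn_neqAle ki andbT; apply: contra ii0 => /eqP ki'.
  by apply/eqP/val_inj.
by rewrite (bigD1 i0)//= g'0; congr (_ * _); apply: eq_bigr => i /g'E ->.
Qed.

(* Behaves as a function of the first [k] variables: it factors out of products
   with functions of the others. *)
Definition past (k : nat) (F : T -> R) : Prop := bmeas F /\
  forall g : 'I_n -> R -> R, (forall i, bmeas (g i)) ->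
    mean P (fun w => F w * \prod_(i < n | (k <= i)%N) g i (X i w)) =
    mean P F * \prod_(i < n | (k <= i)%N) mean P (fun w => g i (X i w)).

Lemma past1 : past 0 (fun=> 1).
Proof.
split=> [|g bg]; first exact: bmeas_cst.
rewrite mean_cst mul1r; under [LHS]eq_Rintegral do rewrite mul1r.
exact: mean_prod_indep.
Qed.

Let prod_bmeas k (g : 'I_n -> R -> R) : (forall i, bmeas (g i)) ->
  bmeas (fun w => \prod_(i < n | (k <= i)%N) g i (X i w)).
Proof. by move=> bg; apply: bmeas_prod => i; exact: bmeas_comp. Qed.

Lemma pastD k F G : past k F -> past k G -> past k (fun w => F w + G w).
Proof.
move=> [bF hF] [bG hG]; split=> [|g bg]; first exact: bmeasD.
under [LHS]eq_Rintegral do rewrite mulrDl.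
rewrite -/(mean P _) !meanD; try (apply: bmeas_itg => //; apply: bmeasM => //; exact: prod_bmeas).
by rewrite hF// hG// mulrDl.
Qed.

Lemma pastZ k c F : past k F -> past k (fun w => c * F w).
Proof.
move=> [bF hF]; split=> [|g bg]; first by apply: bmeasM => //; exact: bmeas_cst.
under [LHS]eq_Rintegral do rewrite -mulrA.
rewrite -/(mean P _) !meanZ ?hF ?mulrA//; apply: bmeas_itg => //.
by apply: bmeasM => //; exact: prod_bmeas.
Qed.

(** Moves one variable from the future to the past: [phi (X i0 w)] is the first factor of the
    product over the indices from [i0] on. Setting the later factors to 1 gives the product rule for
    the means. *)
Lemma past_mul (i0 : 'I_n) F (phi : R -> R) : past i0 F -> bmeas phi ->
  past i0.+1 (fun w => F w * phi (X i0 w)) /\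
  mean P (fun w => F w * phi (X i0 w)) = mean P F * mean P (fun w => phi (X i0 w)).
Proof.
move=> [bF hF] bphi.
have key (g : 'I_n -> R -> R) : (forall i, bmeas (g i)) ->
   mean P (fun w => F w * phi (X i0 w) * \prod_(i < n | (i0.+1 <= i)%N) g i (X i w)) =
   mean P F * mean P (fun w => phi (X i0 w)) *
     \prod_(i < n | (i0.+1 <= i)%N) mean P (fun w => g i (X i w)).
  move=> bg; pose g' (i : 'I_n) : R -> R := if i == i0 then phi else g i.
  have prodE (a b : 'I_n -> R) : (forall i : 'I_n, (i0 < i)%N -> a i = b i) ->
      \prod_(i < n | (i0 <= i)%N) a i = a i0 * \prod_(i < n | (i0 < i)%N) b i.
    move=> ab; rewrite (bigD1 i0)//=; congr (_ * _).
    rewrite (eq_bigl (fun i : 'I_n => (i0 < i)%N)); first exact: eq_bigr.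
    by move=> i; rewrite ltn_neqAle andbC -(inj_eq val_inj) eq_sym.
  have g'E (i : 'I_n) : (i0 < i)%N -> g' i = g i.
    by move=> i0i; rewrite /g' ifF//; apply/eqP => E; rewrite E ltnn in i0i.
  have g'0 : g' i0 = phi by rewrite /g' eqxx.
  have bg' i : bmeas (g' i) by rewrite /g'; case: eqP.
  have := hF g' bg'; rewrite (prodE _ (fun i => mean P (fun w => g i (X i w)))); last first.
    by move=> i /g'E ->.
  rewrite g'0 mulrA => <-.
  congr mean; apply/funext => w; rewrite (prodE _ (fun i => g i (X i w))).
    by rewrite g'0 mulrA.
  by move=> i /g'E ->.
have E : mean P (fun w => F w * phi (X i0 w)) = mean P F * mean P (fun w => phi (X i0 w)).
  have := key (fun=> fun=> 1) (fun=> bmeas_cst _ 1).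
  under [X in X = _]eq_Rintegral do rewrite big1// mulr1.
  by rewrite [in RHS]big1 ?mulr1// => i _; exact: mean_cst.
split=> //; split=> [|g bg]; first by apply: bmeasM => //; exact: bmeas_comp.
by rewrite key// E.
Qed.

Section characteristic_function.
Variables (a dl : 'I_n -> R).
Hypothesis dlcos : forall i,
  `|mean P (fun w => cos (a i * X i w)) - expR (- (a i) ^+ 2 / 2)| <= dl i.
Hypothesis dlsin : forall i, `|mean P (fun w => sin (a i * X i w))| <= dl i.

Let Theta k w := \sum_(i < n | (i < k)%N) a i * X i w.

Let bcos i : bmeas (fun x : R => cos (a i * x)).
Proof.
split; last by exists 1 => x; exact: cos_max.
apply: continuous_measurable_fun => x; apply: continuous_comp; last exact: continuous_cos.
by apply: cvgM; [exact: cvg_cst|exact: cvg_id].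
Qed.

Let bsin i : bmeas (fun x : R => sin (a i * x)).
Proof.
split; last by exists 1 => x; exact: sin_max.
apply: continuous_measurable_fun => x; apply: continuous_comp; last exact: continuous_sin.
by apply: cvgM; [exact: cvg_cst|exact: cvg_id].
Qed.

(** The addition formulas turn step [k.+1] into products covered by [past_mul], which is why the two
    [past] facts are carried along. All means involved are at most 1 in absolute value, so errors
    add. The cosine picks up [dl] twice, from the cosine factor and from the product of sines, hence
    the 2. *)
Let charfun_step (k : nat) : (k <= n)%N ->
  [/\ past k (fun w => cos (Theta k w)), past k (fun w => sin (Theta k w)),
   `|mean P (fun w => cos (Theta k w)) - expR (- (\sum_(i < n | (i < k)%N) (a i) ^+ 2) / 2)|
      <= 2 * \sum_(i < n | (i < k)%N) dl i &
   `|mean P (fun w => sin (Theta k w))| <= \sum_(i < n | (i < k)%N) dl i].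
Proof.
elim: k => [_|k IH kn].
  rewrite /Theta !big_pred0//.
  have -> : (fun w => cos (\sum_(i < n | (i < 0)%N) a i * X i w)) = fun=> 1.
    by apply/funext => w; rewrite big_pred0// cos0.
  have -> : (fun w => sin (\sum_(i < n | (i < 0)%N) a i * X i w)) = fun=> 0.
    by apply/funext => w; rewrite big_pred0// sin0.
  rewrite !mean_cst oppr0 mul0r expR0 subrr normr0 mulr0; split=> //.
    exact: past1.
  have := pastZ 0 past1; congr past; apply/funext => w; exact: mul0r.
have [pc ps ec es] := IH (ltnW kn).
pose i0 := Ordinal kn.
have sumS (F : 'I_n -> R) : \sum_(i < n | (i < k.+1)%N) F i = F i0 + \sum_(i < n | (i < k)%N) F i.
  rewrite (bigD1 i0)//=; congr (_ + _); apply: eq_bigl => i.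
  by rewrite ltnS [RHS]ltn_neqAle andbC -(inj_eq val_inj).
have [pcc mcc] := @past_mul i0 _ _ pc (bcos i0).
have [pcs mcs] := @past_mul i0 _ _ pc (bsin i0).
have [psc msc] := @past_mul i0 _ _ ps (bcos i0).
have [pss mss] := @past_mul i0 _ _ ps (bsin i0).
have cosE : (fun w => cos (Theta k.+1 w)) = (fun w =>
    cos (Theta k w) * cos (a i0 * X i0 w) + (-1) * (sin (Theta k w) * sin (a i0 * X i0 w))).
  by apply/funext => w; rewrite /Theta sumS addrC cosD mulN1r.
have sinE : (fun w => sin (Theta k.+1 w)) = (fun w =>
    sin (Theta k w) * cos (a i0 * X i0 w) + cos (Theta k w) * sin (a i0 * X i0 w)).
  by apply/funext => w; rewrite /Theta sumS addrC sinD.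
rewrite cosE sinE !sumS.
have ibm F : past k.+1 F -> itg P F by case=> bF _; exact: bmeas_itg.
have cle (F : T -> R) : measurable_fun setT F -> `|mean P (fun w => cos (F w))| <= 1.
  move=> mF; apply: norm_mean_bounded => [|w]; last exact: cos_max.
  by apply: measurableT_comp => //; apply: continuous_measurable_fun; exact: continuous_cos.
have mTh : measurable_fun setT (Theta k).
  by apply: measurable_fun_bigsum => i; exact: measurable_funM.
have c1 := cle _ mTh.
have C1 : `|mean P (fun w => cos (a i0 * X i0 w))| <= 1 by apply: cle; exact: measurable_funM.
have eC := dlcos i0; have eS := dlsin i0.
split.
- by apply: pastD => //; exact: pastZ.
- exact: pastD.
- rewrite meanD ?meanZ//; [|exact: ibm..|exact: itgZ (ibm _ pss)].
  rewrite mcc mss opprD mulrDl expRD mulN1r.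
  move: c1 C1 ec es eC eS.
  set c := mean P _; set C := mean P _; set s := mean P (fun w => sin (Theta k w)).
  set S := mean P (fun w => sin _); set e := expR (- a i0 ^+ 2 / 2); set ek := expR _.
  set D := \sum_(i < n | _) dl i => c1 C1 ec es eC eS.
  have e0 : 0 <= e by rewrite expR_ge0.
  have e1 : e <= 1 by rewrite -expR0 ler_expR mulNr oppr_le0 mulr_ge0 ?sqr_ge0.
  have s1 : `|s| <= 1.
    apply: norm_mean_bounded => [|w]; last exact: sin_max.
    by apply: measurableT_comp => //; apply: continuous_measurable_fun; exact: continuous_sin.
  rewrite (_ : c * C - s * S - e * ek = c * (C - e) + (c - ek) * e - s * S); last by ring.
  apply: (le_trans (ler_normB _ _)); apply: (le_trans (lerD (ler_normD _ _) (lexx _))).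
  rewrite !normrM (ger0_norm e0).
  have D0 := le_trans (normr_ge0 _) eS.
  have h1 : `|c| * `|C - e| <= 1 * dl i0 by rewrite ler_pM.
  have h2 : `|c - ek| * e <= (2 * D) * 1 by rewrite ler_pM.
  have h3 : `|s| * `|S| <= 1 * dl i0 by rewrite ler_pM.
  lra.
- rewrite meanD ?msc ?mcs//; [|exact: ibm..].
  apply: (le_trans (ler_normD _ _)); rewrite !normrM addrC lerD//.
    by rewrite -[leRHS]mul1r ler_pM.
  by rewrite -[leRHS]mulr1 ler_pM.
Qed.

Lemma charfun_sum_indep :
  `|mean P (fun w => cos (\sum_(i < n) a i * X i w)) - expR (- (\sum_(i < n) (a i) ^+ 2) / 2)|
      <= 2 * \sum_(i < n) dl i /\
  `|mean P (fun w => sin (\sum_(i < n) a i * X i w))| <= \sum_(i < n) dl i.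
Proof.
have sumE (F : 'I_n -> R) : \sum_(i < n | (i < n)%N) F i = \sum_(i < n) F i.
  by apply: eq_bigl => i; rewrite ltn_ord.
have ThE : Theta n = fun w => \sum_(i < n) a i * X i w.
  by apply/funext => w; rewrite /Theta sumE.
by have [_ _] := charfun_step (leqnn n); rewrite ThE !sumE.
Qed.

End characteristic_function.
End independent_family.

(** * Consequences of the fourth moment bound *)

Section moments.
Context d (T : measurableType d) (R : realType) (P : probability T R).

Section one_variable.
Variables (Y : T -> R) (M : R).
Hypothesis mY : measurable_fun setT Y.
Hypothesis Y4 : ('E_P[fun w => (Y w ^+ 4)%R] <= M%:E)%E.

Lemma itg_pow4 : itg P (fun w => Y w ^+ 4).
Proof.
apply/integrableP; split; first by apply/measurable_EFinP; exact: measurable_funX.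
apply: le_lt_trans (ltry M); move: Y4; rewrite unlock; apply: le_trans.
apply: integral_le => w; rewrite /= lee_fin ger0_norm// exprn_even_ge0//.
Qed.

Lemma mean_pow4 : mean P (fun w => Y w ^+ 4) <= M.
Proof. by rewrite -lee_fin -expectation_mean//; exact: itg_pow4. Qed.

Lemma itg_pow4D1 : itg P (fun w => 1 + Y w ^+ 4).
Proof. by apply: itgD; [exact: itg_cst|exact: itg_pow4]. Qed.

Lemma itg_sqr : itg P (fun w => Y w ^+ 2).
Proof.
apply: itg_dom itg_pow4D1 => [|w]; first exact: measurable_funX.
rewrite ger0_norm ?sqr_ge0// (_ : Y w ^+ 4 = (Y w ^+ 2) ^+ 2); last by ring.
by have := sqr_ge0 (Y w ^+ 2 - 1); have := sqr_ge0 (Y w ^+ 2); nra.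
Qed.

Lemma itg_id : itg P Y.
Proof.
apply: itg_dom (itgD (itg_cst P 1) itg_sqr) => // w /=.
by rewrite ler_norml; have := sqr_ge0 (Y w - 1); have := sqr_ge0 (Y w + 1);
  move=> ? ?; apply/andP; split; nra.
Qed.

Hypothesis Y1 : 'E_P[Y] = 0%E.
Hypothesis Y2 : 'E_P[fun w => (Y w ^+ 2)%R] = 1%E.

Lemma mean_id0 : mean P Y = 0.
Proof. by rewrite mean_fine Y1. Qed.

Lemma mean_sqr1 : mean P (fun w => Y w ^+ 2) = 1.
Proof. by rewrite mean_fine Y2. Qed.

Let mcomp (g : R -> R) (a : R) : continuous g -> measurable_fun setT (fun w => g (a * Y w)).
Proof.
move=> cg; apply: (measurableT_comp (f := g)); first exact: continuous_measurable_fun.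
exact: measurable_funM.
Qed.

(** Both terms are compared with [1 - a ^ 2 / 2], the unit second moment giving this value on the
    side of the cosine. The errors are of order [a ^ 4], and [|a| <= 1] weakens them to the cubic
    order of the bound for the sine. *)
Lemma norm_mean_cos_small (a : R) : `|a| <= 1 ->
  `|mean P (fun w => cos (a * Y w)) - expR (- a ^+ 2 / 2)| <= (M + 1) * `|a| ^+ 3.
Proof.
move=> a1; have M0 : 0 <= M by apply: le_trans mean_pow4; apply: mean_ge0 => w; rewrite exprn_even_ge0.
have icos : itg P (fun w => cos (a * Y w)).
  by apply: (@itg_bounded _ _ _ _ _ 1) => [|w]; [exact/mcomp/continuous_cos|exact: cos_max].
have iq : itg P (fun w => 1 - a ^+ 2 / 2 * Y w ^+ 2).
  by apply: itgB; [exact: itg_cst|apply: itgZ; exact: itg_sqr].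
have h1 : `|mean P (fun w => cos (a * Y w)) - (1 - a ^+ 2 / 2)| <= a ^+ 4 * M.
  have -> : mean P (fun w => cos (a * Y w)) - (1 - a ^+ 2 / 2) =
      mean P (fun w => cos (a * Y w) - (1 - a ^+ 2 / 2 * Y w ^+ 2)).
    rewrite meanB// meanB; [|exact: itg_cst|apply: itgZ; exact: itg_sqr].
    by rewrite mean_cst meanZ ?mean_sqr1 ?mulr1//; exact: itg_sqr.
  apply: (@le_trans _ _ (mean P (fun w => a ^+ 4 * Y w ^+ 4))); last first.
    rewrite meanZ; last exact: itg_pow4.
    by rewrite ler_wpM2l ?mean_pow4// exprn_even_ge0.
  apply: norm_mean_le; [exact: itgB|by apply: itgZ; exact: itg_pow4|move=> w].
  have := norm_cos_sub_quadratic (a * Y w); rewrite !exprMn.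
  by rewrite (_ : a ^+ 2 * Y w ^+ 2 / 2 = a ^+ 2 / 2 * Y w ^+ 2)//; ring.
have h2 : `|expR (- a ^+ 2 / 2) - (1 - a ^+ 2 / 2)| <= a ^+ 4 / 4.
  have := @norm_expRN_sub_linear R (a ^+ 2 / 2); rewrite mulNr => H.
  by apply: (le_trans (H _)); [rewrite divr_ge0 ?sqr_ge0|rewrite le_eqVlt; apply/orP; left; apply/eqP; field].
have h3 : a ^+ 4 <= `|a| ^+ 3.
  rewrite -(ger0_norm (_ : 0 <= a ^+ 4)) ?exprn_even_ge0// normrX.
  by apply: ler_wiXn2l.
have a30 : 0 <= `|a| ^+ 3 by rewrite exprn_ge0.
have h4 : a ^+ 4 * M <= `|a| ^+ 3 * M by rewrite ler_wpM2r.
rewrite (_ : _ - _ = (mean P (fun w => cos (a * Y w)) - (1 - a ^+ 2 / 2))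
   - (expR (- a ^+ 2 / 2) - (1 - a ^+ 2 / 2))); last by ring.
by rewrite (le_trans (ler_normB _ _))//; nra.
Qed.

(** Subtracting [a * Y] changes nothing, as its mean is 0. The remaining cubic term is integrable
    through [|y| ^ 3 <= 1 + y ^ 4]. *)
Lemma norm_mean_sin_small (a : R) :
  `|mean P (fun w => sin (a * Y w))| <= (M + 1) * `|a| ^+ 3.
Proof.
have isin : itg P (fun w => sin (a * Y w)).
  by apply: (@itg_bounded _ _ _ _ _ 1) => [|w]; [exact/mcomp/continuous_sin|exact: sin_max].
have iaY : itg P (fun w => a * Y w) by apply: itgZ; exact: itg_id.
have -> : mean P (fun w => sin (a * Y w)) = mean P (fun w => sin (a * Y w) - a * Y w).
  by rewrite meanB// meanZ ?mean_id0 ?mulr0 ?subr0//; exact: itg_id.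
apply: (@le_trans _ _ (mean P (fun w => `|a| ^+ 3 * (1 + Y w ^+ 4)))); last first.
  rewrite meanZ; last exact: itg_pow4D1.
  rewrite meanD; [|exact: itg_cst|exact: itg_pow4].
  by rewrite mean_cst mulrC ler_wpM2r ?exprn_ge0// addrC lerD2r mean_pow4.
apply: norm_mean_le; [exact: itgB|by apply: itgZ; exact: itg_pow4D1|move=> w].
apply: (le_trans (norm_sin_sub_id _)); rewrite normrM exprMn ler_wpM2l ?exprn_ge0//.
rewrite -(ger0_norm (_ : 0 <= Y w ^+ 4)) ?exprn_even_ge0// normrX.
have [y1|y1] := leP `|Y w| 1.
  by rewrite (le_trans (exprn_ile1 3 (normr_ge0 _) y1))// lerDl exprn_ge0.
by rewrite (le_trans (ler_weXn2l (ltW y1) (_ : (3 <= 4)%N)))// lerDr.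
Qed.

End one_variable.

(** Truncation brings the errors into the class [bmeas], where the product rule holds. *)
Definition clamp (N : nat) (x : R) : R := Num.max (- N%:R) (Num.min x N%:R).

Lemma clamp_le N x : `|clamp N x| <= `|x|.
Proof.
rewrite /clamp; have N0 := ler0n R N; have [h|h] := leP x N%:R.
  have [h'|h'] := leP (- N%:R) x => //.
  by rewrite normrN ger0_norm// ltr0_norm; lra.
have [h'|h'] := leP (- N%:R) (N%:R : R).
  by rewrite ger0_norm// gtr0_norm; lra.
lra.
Qed.

Lemma clamp_bound N x : `|clamp N x| <= N%:R.
Proof.
rewrite /clamp; have N0 := ler0n R N; have [h|h] := leP x N%:R.
  have [h'|h'] := leP (- N%:R) x; rewrite ler_norml; apply/andP; split; lra.
have [h'|h'] := leP (- N%:R) (N%:R : R); rewrite ler_norml; apply/andP; split; lra.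
Qed.

Lemma clamp_cvg x : (fun N => clamp N x) @ \oo --> x.
Proof.
apply: cvg_near_cst; exists (Num.truncn `|x|).+1 => // N /= xN.
have : `|x| <= N%:R.
  by rewrite ltW// (lt_le_trans (truncnS_gt _))// ler_nat.
rewrite ler_norml => /andP[h1 h2]; rewrite /clamp (min_idPl h2) (max_idPr _)//.
Qed.

Lemma measurable_clamp N : measurable_fun setT (clamp N).
Proof. by apply: measurable_maxr => //; exact: measurable_minr. Qed.

Lemma bmeas_clamp N : bmeas (clamp N).
Proof. by split; [exact: measurable_clamp|exists N%:R; exact: clamp_bound]. Qed.

Variables (n : nat) (X : 'I_n -> T -> R) (M : R).
Hypothesis mX : forall i, measurable_fun setT (X i).
Hypothesis indX : mutually_independent P X.
Hypothesis X4 : forall i, ('E_P[fun w => (X i w ^+ 4)%R] <= M%:E)%E.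
Hypothesis X1 : forall i, 'E_P[X i] = 0%E.
Hypothesis X2 : forall i, 'E_P[fun w => (X i w ^+ 2)%R] = 1%E.

Lemma itg_mul (i j : 'I_n) : itg P (fun w => X i w * X j w).
Proof.
apply: itg_dom (itgD (itg_sqr (mX i) (X4 i)) (itg_sqr (mX j) (X4 j))) => [|w].
  exact: measurable_funM.
have := sqr_ge0 (X i w - X j w); have := sqr_ge0 (X i w + X j w).
by rewrite ler_norml => h1 h2; apply/andP; split; nra.
Qed.

(** The product rule is available for bounded functions only, so it is applied to the truncations.
    Dominated convergence, with [X i ^+ 2 + X j ^+ 2] as majorant, then gives the limit. *)
Lemma mean_mul0 (i j : 'I_n) : i != j -> mean P (fun w => X i w * X j w) = 0.
Proof.
move=> ij.
have E N : mean P (fun w => clamp N (X i w) * clamp N (X j w)) =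
    mean P (fun w => clamp N (X i w)) * mean P (fun w => clamp N (X j w)).
  pose g (k : 'I_n) : R -> R := if (k == i) || (k == j) then clamp N else fun=> 1.
  have gi : g i = clamp N by rewrite /g eqxx.
  have gj : g j = clamp N by rewrite /g eqxx orbT.
  have gk k : (k != i) && (k != j) -> g k = fun=> 1.
    by move=> /andP[/negbTE ki /negbTE kj]; rewrite /g ki kj.
  have prodE (F : 'I_n -> R) : (forall k, (k != i) && (k != j) -> F k = 1) ->
      \prod_(k < n) F k = F i * F j.
    move=> F1; rewrite (bigD1 i)//= (bigD1 j) 1?eq_sym//=.
    by rewrite [X in _ * (_ * X)]big1 ?mulr1.
  have := @mean_prod_indep _ _ _ P _ _ mX indX g; rewrite prodE; last first.
    by move=> k /gk ->; exact: mean_cst.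
  rewrite gi gj => <-; last first.
    move=> k; rewrite /g; case: ifP => _; [exact: bmeas_clamp|exact: bmeas_cst].
  congr mean; apply/funext => w; rewrite prodE ?gi ?gj// => k /gk ->//.
have mc N k : measurable_fun setT (fun w => clamp N (X k w)).
  by apply: measurableT_comp => //; exact: measurable_clamp.
have cl : (fun N => mean P (fun w => clamp N (X i w) * clamp N (X j w))) @ \oo -->
    mean P (fun w => X i w * X j w).
  apply: (@mean_dominated _ _ _ P _ _ (fun w => X i w ^+ 2 + X j w ^+ 2)).
  - by move=> N; exact: measurable_funM.
  - exact: measurable_funM.
  - by move=> w; apply: cvgM; exact: clamp_cvg.
  - move=> N w; rewrite normrM.
    apply: (@le_trans _ _ (`|X i w| * `|X j w|)); first by rewrite ler_pM// clamp_le.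
    rewrite -[X i w ^+ 2]real_normK ?num_real// -[X j w ^+ 2]real_normK ?num_real//.
    by have := sqr_ge0 (`|X i w| - `|X j w|); have := sqr_ge0 (`|X i w| + `|X j w|); nra.
  - by apply: itgD; apply: itg_sqr.
have c1 k : (fun N => mean P (fun w => clamp N (X k w))) @ \oo --> (0 : R).
  rewrite -(mean_id0 (X1 k)).
  apply: (@mean_dominated _ _ _ P _ _ (fun w => `|X k w|)) => //.
  - by move=> w; exact: clamp_cvg.
  - by move=> N w; exact: clamp_le.
  - exact: integrable_norm (itg_id (mX k) (X4 k)).
have := cvgM (c1 i) (c1 j); rewrite mulr0 => c0.
have cl0 : (fun N => mean P (fun w => clamp N (X i w) * clamp N (X j w))) @ \oo --> (0 : R).
  by under eq_fun do rewrite E; exact: c0.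
exact: (cvg_unique _ cl cl0).
Qed.

Lemma itg_sum_sqr (a : 'I_n -> R) : itg P (fun w => (\sum_(i < n) a i * X i w) ^+ 2).
Proof.
have -> : (fun w => (\sum_(i < n) a i * X i w) ^+ 2) =
    (fun w => \sum_(i < n) \sum_(j < n) a i * a j * (X i w * X j w)).
  apply/funext => w; rewrite expr2 big_distrlr/=.
  by apply: eq_bigr => i _; apply: eq_bigr => j _; ring.
by apply: itg_sum => i; apply: itg_sum => j; apply: itgZ; exact: itg_mul.
Qed.

Lemma mean_sum_sqr (a : 'I_n -> R) :
  mean P (fun w => (\sum_(i < n) a i * X i w) ^+ 2) = \sum_(i < n) (a i) ^+ 2.
Proof.
have -> : (fun w => (\sum_(i < n) a i * X i w) ^+ 2) =
    (fun w => \sum_(i < n) \sum_(j < n) a i * a j * (X i w * X j w)).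
  apply/funext => w; rewrite expr2 big_distrlr/=.
  by apply: eq_bigr => i _; apply: eq_bigr => j _; ring.
have iij i j : itg P (fun w => a i * a j * (X i w * X j w)) by apply: itgZ; exact: itg_mul.
rewrite mean_sum => [|i]; last exact: itg_sum.
apply: eq_bigr => i _; rewrite mean_sum// (bigD1 i)//= big1 ?addr0 => [|j ji].
  rewrite meanZ; last exact: itg_mul.
  rewrite (_ : mean P _ = 1) ?mulr1 ?expr2//.
  by rewrite -(mean_sqr1 (X2 i)); congr mean; apply/funext => w; rewrite expr2.
by rewrite meanZ ?mean_mul0 ?mulr0// 1?eq_sym//; exact: itg_mul.
Qed.

End moments.

(** * Convergence in distribution from characteristic functions, up to a small error *)

Section weak_convergence.
Context (R : realType).

Lemma trig_poly_bmeas (p : R -> R) : trig_poly p -> bmeas p.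
Proof.
have lin (g : R -> R) t : continuous g -> measurable_fun setT (fun x : R => g (t * x)).
  move=> cg; apply: (measurableT_comp (f := g)); first exact: continuous_measurable_fun.
  exact: measurable_funM.
elim=> {p} [|t|t|p q _ bp _ bq|c p _ bp].
- exact: bmeas_cst.
- by split; [exact: (lin cos t (@continuous_cos R))|exists 1 => x; exact: cos_max].
- by split; [exact: (lin sin t (@continuous_sin R))|exists 1 => x; exact: sin_max].
- exact: bmeasD.
- by apply: bmeasM => //; exact: bmeas_cst.
Qed.

(** The minimum is a bounded majorant of the indicator of [|W| >= N.+1] that tends to 0 pointwise.
    Dominated convergence then controls the tail of [W] without any moment. *)
Lemma tail_small d (T : measurableType d) (Q : probability T R) (W : T -> R) (e : R) :
  measurable_fun setT W -> 0 < e ->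
  exists N : nat, mean Q (fun w => Num.min 1 (`|W w| / N.+1%:R)) <= e.
Proof.
move=> mW e0.
have c0 : (fun N => mean Q (fun w => Num.min 1 (`|W w| / N.+1%:R))) @ \oo --> (0 : R).
  rewrite -(mean_cst Q 0); apply: (@mean_dominated _ _ _ Q _ _ (fun=> 1)).
  - move=> N; apply: measurable_minr => //.
    by apply: measurable_funM => //; exact: measurableT_comp.
  - exact: measurable_cst.
  - move=> w; have l0 : (fun N => `|W w| / N.+1%:R) @ \oo --> (0 : R).
      rewrite -(mulr0 `|W w|); apply: cvgM; first exact: cvg_cst.
      exact: cvg_harmonic.
    apply: (squeeze_cvgr _ (cvg_cst (0 : R)) l0).
    by apply: nearW => N; rewrite le_min ler01 divr_ge0//= ge_min lexx orbT.
  - move=> N w; have t0 : 0 <= Num.min 1 (`|W w| / N.+1%:R) by rewrite le_min ler01 divr_ge0.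
    by rewrite (ger0_norm t0) ge_min lexx.
  - exact: itg_cst.
have /cvgrPdist_le /(_ _ e0) [N _ /(_ N (leqnn N))] := c0.
by rewrite /= sub0r normrN => H; exists N; exact: le_trans (ler_norm _) H.
Qed.

(** [F] need not be measurable: it lies between the integrable functions [g - e] and [g + e], and
    the integral is monotone. The log-ratio enters expectations in this way. *)
Lemma expectation_bounds d (T : measurableType d) (P : probability T R) (F g e : T -> R) :
  itg P g -> itg P e -> (forall w, `|F w - g w| <= e w) ->
  'E_P[F] \is a fin_num /\ `|fine 'E_P[F] - mean P g| <= mean P e.
Proof.
move=> ig ie Fge.
have lo : ((mean P g - mean P e)%:E <= 'E_P[F])%E.
  rewrite -meanB// -expectation_mean ?unlock; last exact: itgB.
  by apply: integral_le => w; rewrite lee_fin; have := Fge w; rewrite ler_norml; lra.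
have up : ('E_P[F] <= (mean P g + mean P e)%:E)%E.
  rewrite -meanD// -expectation_mean ?unlock; last exact: itgD.
  by apply: integral_le => w; rewrite lee_fin; have := Fge w; rewrite ler_norml; lra.
case: ('E_P[F]) lo up => // r; rewrite !lee_fin => lo up; split=> //=.
by rewrite ler_norml; apply/andP; split; lra.
Qed.

Section levy_slutsky.
Context (dn : nat -> measure_display) (T : forall n, measurableType (dn n)).
Context (P : forall n, probability (T n) R).
Context d (Omega : measurableType d) (Q : probability Omega R).
Unset Implicit Arguments.
Variables (X S G : forall n, T n -> R) (W : Omega -> R) (V : R).
Set Implicit Arguments.
Hypothesis V_gt0 : 0 < V.
Hypothesis mS : forall n, measurable_fun setT (S n).
Hypothesis mW : measurable_fun setT W.
Hypothesis itgS2 : forall n, itg (P n) (fun w => S n w ^+ 2).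
Hypothesis meanS2 : \forall n \near \oo, mean (P n) (fun w => S n w ^+ 2) <= V.
Hypothesis itgG : forall n, itg (P n) (G n).
Hypothesis G_ge0 : forall n w, 0 <= G n w.
Hypothesis meanG : \forall n \near \oo, mean (P n) (G n) <= V.
Hypothesis cvg_cos : forall t,
  (fun n => mean (P n) (fun w => cos (t * S n w))) @ \oo --> mean Q (fun w => cos (t * W w)).
Hypothesis cvg_sin : forall t,
  (fun n => mean (P n) (fun w => sin (t * S n w))) @ \oo --> mean Q (fun w => sin (t * W w)).
Hypothesis XS : forall e, 0 < e ->
  \forall n \near \oo, forall w, `|X n w - S n w| <= e * G n w.

Lemma cvg_trig_poly (p : R -> R) : trig_poly p ->
  (fun n => mean (P n) (fun w => p (S n w))) @ \oo --> mean Q (fun w => p (W w)).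
Proof.
elim=> {p} [|t|t|p q tp cp tq cq|c p tp cp].
- rewrite mean_cst; under eq_fun do rewrite mean_cst; exact: cvg_cst.
- exact: cvg_cos.
- exact: cvg_sin.
- have it r : trig_poly r -> forall n, itg (P n) (fun w => r (S n w)).
    by move=> tr n; apply: bmeas_itg; apply: bmeas_comp => //; exact: trig_poly_bmeas.
  rewrite meanD; [|by apply: bmeas_itg; apply: bmeas_comp => //; exact: trig_poly_bmeas..].
  under eq_fun => n do [rewrite meanD; [|exact: it..]].
  exact: cvgD.
- rewrite meanZ; last by apply: bmeas_itg; apply: bmeas_comp => //; exact: trig_poly_bmeas.
  under eq_fun => n.
    rewrite meanZ; last by apply: bmeas_itg; apply: bmeas_comp => //; exact: trig_poly_bmeas.
    over.
  by apply: cvgM => //; exact: cvg_cst.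
Qed.

(* [h] is replaced by a trigonometric polynomial that is close to it on
   [[-L, L]] and bounded by the same constant elsewhere. *)
Lemma cvg_dist_of_charfun : cvg_dist P X Q W.
Proof.
move=> h hc [B hB].
have B0 : 0 <= B by apply: le_trans (hB 0).
have bh : bmeas h by split; [exact: continuous_measurable_fun|exists B].
have ihW : itg Q (fun w => h (W w)) by apply: bmeas_itg; exact: bmeas_comp.
rewrite expectation_mean//; set m := mean Q _.
suff key e : 0 < e -> \forall n \near \oo, 'E_(P n)[fun w => h (X n w)] \is a fin_num /\
    `|fine 'E_(P n)[fun w => h (X n w)] - m| <= e.
  apply: cvg_EFin; first by apply: filterS (key 1 ltr01) => n [].
  apply/cvgrPdist_le => e /key; apply: filterS => n [_] /=.
  by rewrite distrC.
move=> e0.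
(* Error budget: [k] bounds each of three tail weights, for large [W], large [S] and large [X - S].
   The total is [4 * e' + 6 * B * k], where the first term is [e / 2] and the second at most
   [e / 2]. *)
pose k := e / (12 * (B + 1)); pose e' := e / 8.
have k0 : 0 < k by rewrite divr_gt0// mulr_gt0//; lra.
have e'0 : 0 < e' by rewrite divr_gt0.
have kB : 2 * B * k <= e / 6.
  rewrite /k mulrA ler_pdivrMr; last by rewrite mulr_gt0//; lra.
  by have := mulr_ge0 B0 (ltW e0); nra.
have [N tailN] := tail_small Q mW k0.
have Vk0 : 0 < V / k by rewrite divr_gt0.
(* The first summand serves the tail of [W]. The second gives [V / L ^ 2 <= k], since [L >= 1] and
   [L >= V / k]. *)
pose L := N.+1%:R + V / k.
have N1 : (1 : R) <= N.+1%:R by rewrite ler1n.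
have L0 : 0 < L by rewrite /L; lra.
have LV : V / L ^+ 2 <= k.
  rewrite ler_pdivrMr ?exprn_gt0// mulrC -ler_pdivrMr//.
  have VL : V / k <= L by rewrite /L; lra.
  have L1 : 1 <= L by rewrite /L; lra.
  by rewrite (le_trans VL)// expr2 ler_peMl// ltW.
have [p [tp pB pL]] := trig_approx hc hB L0 e'0.
have [dl dl0 hdl] := continuous_unif_segment L hc e'0.
(* The precision requested from [XS]. The weight [G / dl * (k * dl / V)] is then at least 1 wherever
   [X] and [S] differ by [dl] or more, and its mean is at most [k]. *)
have n20 : 0 < k * dl / V by rewrite divr_gt0// mulr_gt0.
have bp := trig_poly_bmeas tp.
have ipW : itg Q (fun w => p (W w)) by apply: bmeas_itg; exact: bmeas_comp.
have ipS n : itg (P n) (fun w => p (S n w)) by apply: bmeas_itg; exact: bmeas_comp.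
have hW : `|mean Q (fun w => p (W w)) - m| <= e' + 2 * B * k.
  rewrite /m -meanB//.
  have it : itg Q (fun w => Num.min 1 (`|W w| / N.+1%:R)).
    apply: (@itg_bounded _ _ _ _ _ 1) => [|w].
      apply: measurable_minr => //.
      by apply: measurable_funM => //; exact: measurableT_comp.
    have t0 : 0 <= Num.min 1 (`|W w| / N.+1%:R) by rewrite le_min ler01 divr_ge0.
    by rewrite (ger0_norm t0) ge_min lexx.
  apply: (@le_trans _ _ (mean Q (fun w => e' + 2 * B * Num.min 1 (`|W w| / N.+1%:R)))); last first.
    rewrite meanD ?mean_cst ?meanZ//; [|exact: itg_cst|exact: itgZ].
    by rewrite lerD2l ler_wpM2l// mulr_ge0.
  apply: norm_mean_le; [exact: itgB|apply: itgD; [exact: itg_cst|exact: itgZ]|move=> w].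
  have t0 : 0 <= Num.min 1 (`|W w| / N.+1%:R) by rewrite le_min ler01 divr_ge0.
  have [wL|wL] := leP `|W w| L.
    by rewrite distrC (le_trans (pL _ wL))// lerDl mulr_ge0// mulr_ge0.
  rewrite (min_idPl _); last by rewrite ler_pdivlMr// mul1r; move: wL; rewrite /L; lra.
  by rewrite (le_trans (ler_normB _ _))//; have := pB (W w); have := hB (W w); lra.
near=> n.
(* Where [S] is within [L] and [X] within [dl] of it, [2 * e'] suffices. Elsewhere one of the two
   weights is at least 1 and [2 * B] takes over. Weights stand in for indicators because the event
   on [X] may fail to be measurable. *)
pose E w := 2 * e' + 2 * B * (S n w ^+ 2 / L ^+ 2 + G n w / dl * (k * dl / V)).
have iE : itg (P n) E.
  apply: itgD; first exact: itg_cst.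
  apply: itgZ; apply: itgD.
    by under eq_fun do rewrite mulrC; exact: itgZ.
  under eq_fun do rewrite -mulrA mulrC; exact: itgZ.
have mE : mean (P n) E <= 2 * e' + 2 * B * (k + k).
  rewrite /E meanD; [|exact: itg_cst|]; last first.
    apply: itgZ; apply: itgD.
      by under eq_fun do rewrite mulrC; exact: itgZ.
    under eq_fun do rewrite -mulrA mulrC; exact: itgZ.
  rewrite mean_cst lerD2l meanZ; last first.
    apply: itgD.
      by under eq_fun do rewrite mulrC; exact: itgZ.
    under eq_fun do rewrite -mulrA mulrC; exact: itgZ.
  rewrite ler_wpM2l ?mulr_ge0//.
  have -> : (fun w => S n w ^+ 2 / L ^+ 2 + G n w / dl * (k * dl / V)) =
      (fun w => (L ^+ 2)^-1 * S n w ^+ 2 + (k / V) * G n w).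
    by apply/funext => w; field; rewrite !gt_eqF.
  rewrite meanD ?meanZ//; [|exact: itgZ..].
  have h1 : mean (P n) (fun w => S n w ^+ 2) <= V by near: n.
  have h2 : mean (P n) (G n) <= V by near: n.
  apply: lerD.
    by rewrite mulrC (le_trans _ LV)// ler_pM2r// invr_gt0 exprn_gt0.
  by rewrite mulrAC ler_pdivrMr// ler_pM2l.
have XSn : forall w, `|X n w - S n w| <= k * dl / V * G n w by near: n; exact: XS.
have hpE w : `|h (X n w) - p (S n w)| <= E w.
  rewrite /E.
  have s0 : 0 <= S n w ^+ 2 / L ^+ 2 by rewrite divr_ge0 ?sqr_ge0.
  have g0 : 0 <= G n w / dl * (k * dl / V).
    by apply: mulr_ge0; [apply: divr_ge0; [exact: G_ge0|exact: ltW]|exact: ltW].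
  have bad : `|h (X n w) - p (S n w)| <= 2 * B.
    by rewrite (le_trans (ler_normB _ _))//; have := pB (S n w); have := hB (X n w); lra.
  have B20 : 0 <= 2 * B by rewrite mulr_ge0.
  have [sL|sL] := leP `|S n w| L; last first.
    have : 1 <= S n w ^+ 2 / L ^+ 2.
      rewrite ler_pdivlMr ?exprn_gt0// mul1r -[S n w ^+ 2]real_normK ?num_real//.
      by rewrite lerXn2r ?nnegrE// ltW.
    nra.
  have [xs|xs] := ltP `|S n w - X n w| dl.
    have := hdl _ _ sL xs; have := pL _ sL => p1 p2.
    apply: (@le_trans _ _ (2 * e')); last first.
      by rewrite lerDl mulr_ge0// addr_ge0.
    rewrite (_ : _ - _ = (h (S n w) - p (S n w)) - (h (S n w) - h (X n w))); last by ring.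
    by rewrite (le_trans (ler_normB _ _))//; lra.
  have : 1 <= G n w / dl * (k * dl / V).
    rewrite mulrAC ler_pdivlMr// mul1r (le_trans xs)// distrC mulrC; exact: XSn.
  nra.
have [fin hE] := expectation_bounds (ipS n) iE hpE.
split=> //.
have h3 : `|mean Q (fun w => p (W w)) - mean (P n) (fun w => p (S n w))| <= e'.
  by near: n; have /cvgrPdist_le := cvg_trig_poly tp; exact.
rewrite (_ : _ - m = (fine 'E_(P n)[fun w => h (X n w)] - mean (P n) (fun w => p (S n w)))
  - (mean Q (fun w => p (W w)) - mean (P n) (fun w => p (S n w)))
  + (mean Q (fun w => p (W w)) - m)); last by ring.
apply: (le_trans (ler_normD _ _)).
apply: (le_trans (lerD (ler_normB _ _) (lexx _))).
rewrite /e' in h3 hW mE *; lra.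
Unshelve. all: by end_near. Qed.

End levy_slutsky.
End weak_convergence.

(** * The Gaussian likelihood as a function of the parameter *)

Section likelihood.
Context (R : realType) (K : nat).

Lemma dotvDr (x u v : 'rV[R]_K) : dotv x (u + v) = dotv x u + dotv x v.
Proof. by rewrite /dotv -big_split/=; apply: eq_bigr => k _; rewrite mxE mulrDr. Qed.

Lemma dotvZr (x u : 'rV[R]_K) (c : R) : dotv x (c *: u) = c * dotv x u.
Proof. by rewrite /dotv mulr_sumr; apply: eq_bigr => k _; rewrite mxE mulrCA. Qed.

Lemma dotvBr (x u v : 'rV[R]_K) : dotv x (u - v) = dotv x u - dotv x v.
Proof. by rewrite -scaleN1r dotvDr dotvZr mulN1r. Qed.

Lemma norm_dotv_le (x u : 'rV[R]_K) (r : R) : (forall k, `|u 0 k| <= r) ->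
  `|dotv x u| <= r * \sum_(k < K) `|x 0 k|.
Proof.
move=> ur; rewrite (le_trans (ler_norm_sum _ _ _))// mulr_sumr; apply: ler_sum => k _.
by rewrite normrM mulrC ler_wpM2r.
Qed.

Lemma sqr_sum_le (y : 'I_K -> R) : (\sum_(k < K) y k) ^+ 2 <= K%:R * \sum_(k < K) y k ^+ 2.
Proof.
rewrite expr2 big_distrlr/=.
apply: (@le_trans _ _ (\sum_(i < K) \sum_(j < K) (y i ^+ 2 / 2 + y j ^+ 2 / 2))).
  by apply: ler_sum => i _; apply: ler_sum => j _; have := sqr_ge0 (y i - y j); nra.
rewrite le_eqVlt; apply/orP; left; apply/eqP.
under [LHS]eq_bigr do rewrite big_split/= sumr_const card_ord -mulr_suml -[_ *+ K]mulr_natr.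
by rewrite big_split/= sumr_const card_ord -[_ *+ K]mulr_natr -!mulr_suml; lra.
Qed.

Variables (n : nat) (X : 'M[R]_(n, K)).

Definition qform (v : 'rV[R]_K) : R := (\sum_(i < n) dotv (row i X) v ^+ 2) / n%:R.

Lemma sum_dotv_sqr (v : 'rV[R]_K) :
  \sum_(i < n) dotv (row i X) v ^+ 2 = quadf (X^T *m X) v.
Proof.
rewrite /quadf.
under eq_bigr do rewrite expr2 /dotv big_distrlr/=.
rewrite exchange_big/=; apply: eq_bigr => j _; rewrite exchange_big/=; apply: eq_bigr => k _.
rewrite !mxE mulr_sumr mulr_suml; apply: eq_bigr => i _; rewrite !mxE; ring.
Qed.

(** A difference of squares is a product of two linear forms. One factor [K] comes from
    Cauchy-Schwarz and the other from summing over the columns. Their normalisation cancels [n], so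
    the bound is uniform in [n]. *)
Lemma qform_dist (v v' : 'rV[R]_K) (r D : R) : (0 < n)%N ->
  (forall k : 'I_K, \sum_(i < n) X i k ^+ 2 = n%:R) ->
  (forall k, `|(v - v') 0 k| <= r) -> (forall k, `|(v + v') 0 k| <= D) ->
  0 <= r -> 0 <= D ->
  `|qform v - qform v'| <= r * D * K%:R ^+ 2.
Proof.
move=> n0 hX hr hD r0 D0; have nR : (0 : R) < n%:R by rewrite ltr0n.
rewrite /qform -mulrBl -sumrB normrM [`|n%:R^-1|]gtr0_norm ?invr_gt0// ler_pdivrMr//.
apply: (le_trans (ler_norm_sum _ _ _)).
apply: (@le_trans _ _ (\sum_(i < n) r * D * (K%:R * \sum_(k < K) X i k ^+ 2))).
  apply: ler_sum => i _.
  have -> : dotv (row i X) v ^+ 2 - dotv (row i X) v' ^+ 2 =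
      dotv (row i X) (v - v') * dotv (row i X) (v + v').
    by rewrite (dotvDr _ v v') dotvBr; ring.
  rewrite normrM.
  apply: (le_trans (ler_pM _ _ (norm_dotv_le _ hr) (norm_dotv_le _ hD))) => //.
  rewrite mulrACA ler_wpM2l ?mulr_ge0// -expr2 (le_trans (sqr_sum_le _))//.
  rewrite ler_wpM2l//; apply: ler_sum => k _.
  by rewrite mxE real_normK ?num_real.
rewrite -mulr_sumr -mulr_sumr exchange_big/=.
under eq_bigr do rewrite hX.
by rewrite sumr_const card_ord -[_ *+ K]mulr_natr; lra.
Qed.

Variables (beta0 : 'rV[R]_K) (eps : 'I_n -> R).

Definition score (k : 'I_K) : R := \sum_(i < n) X i k / Num.sqrt n%:R * eps i.

Definition logdiff (v : 'rV[R]_K) : R := \sum_(k < K) v 0 k * score k - qform v / 2.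

Definition likelihood (b : 'rV[R]_K) : R :=
  \prod_(i < n) npdf (dotv (row i X) b) n%:R
    (Num.sqrt n%:R * (dotv (row i X) ((Num.sqrt n%:R)^-1 *: beta0) + eps i)).

(** The two scalings by the root of [n] cancel in the signal, so the residual is [sqrt n * eps i]
    minus the linear form in [b - beta0]. In its square divided by [2 * n], the terms free of [b] go
    into [A], which depends on the sample but cancels between balls. *)
Lemma likelihoodE : (0 < n)%N -> exists2 A : R, 0 < A &
  forall b, likelihood b = A * expR (logdiff (b - beta0)).
Proof.
move=> n0; have nR : (0 : R) < n%:R by rewrite ltr0n.
have s0 : 0 < Num.sqrt (n%:R : R) by rewrite sqrtr_gt0.
have sn0 : Num.sqrt (n%:R : R) != 0 by rewrite gt_eqF.
have s2 : Num.sqrt (n%:R : R) ^+ 2 = n%:R by rewrite sqr_sqrtr// ltW.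
have c0 : 0 < Num.sqrt (2 * pi * n%:R : R).
  by rewrite sqrtr_gt0 mulr_gt0// mulr_gt0// pi_gt0.
exists (\prod_(i < n) (expR (- (eps i ^+ 2) / 2) / Num.sqrt (2 * pi * n%:R))).
  by apply: prodr_gt0 => i _; rewrite divr_gt0// expR_gt0.
move=> b; set v := b - beta0.
have -> : logdiff v = \sum_(i < n) (dotv (row i X) v * eps i / Num.sqrt n%:R
    - dotv (row i X) v ^+ 2 / (2 * n%:R)).
  rewrite sumrB /logdiff; congr (_ - _).
    under eq_bigr do rewrite mulr_sumr.
    rewrite exchange_big/=; apply: eq_bigr => i _; rewrite /dotv !mulr_suml.
    by apply: eq_bigr => k _; rewrite [row i X 0 k]mxE; ring.
  rewrite /qform mulr_suml mulr_suml; apply: eq_bigr => i _; by field; rewrite gt_eqF.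
rewrite expR_sum -big_split/=; apply: eq_bigr => i _.
rewrite mulrAC -expRD /npdf; congr (expR _ / _).
have -> : Num.sqrt n%:R * (dotv (row i X) ((Num.sqrt n%:R)^-1 *: beta0) + eps i)
    - dotv (row i X) b = Num.sqrt n%:R * eps i - dotv (row i X) v.
  by rewrite dotvZr dotvBr; field.
move: (Num.sqrt n%:R) s2 sn0 => s s2 sn0; rewrite -s2; by field.
Qed.

(** Each normal density is at most its value at the mode. This makes the evidence finite. *)
Lemma likelihood_le : exists c : R, forall b, likelihood b <= c.
Proof.
exists (\prod_(i < n) (Num.sqrt (2 * pi * n%:R : R))^-1) => b.
apply: ler_prod => i _; rewrite /npdf; apply/andP; split.
  by rewrite divr_ge0 ?expR_ge0 ?sqrtr_ge0.
rewrite ler_piMl ?invr_ge0 ?sqrtr_ge0// -expR0 ler_expR mulNr oppr_le0 divr_ge0 ?sqr_ge0//.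
Qed.

(** By [|s| <= 1 + s ^ 2] the score enters only through its squares, whose means are known. This is
    the origin of the random factor [G] in the main proof. *)
Lemma logdiff_dist (v v' : 'rV[R]_K) (r D : R) : (0 < n)%N ->
  (forall k : 'I_K, \sum_(i < n) X i k ^+ 2 = n%:R) ->
  (forall k, `|(v - v') 0 k| <= r) -> (forall k, `|(v + v') 0 k| <= D) ->
  0 <= r -> 0 <= D ->
  `|logdiff v - logdiff v'| <= r * (K%:R + \sum_(k < K) score k ^+ 2) + r * D * K%:R ^+ 2.
Proof.
move=> n0 hX hr hD r0 D0.
have -> : logdiff v - logdiff v' = \sum_(k < K) (v - v') 0 k * score k - (qform v - qform v') / 2.
  have -> : \sum_(k < K) (v - v') 0 k * score k =
     \sum_(k < K) v 0 k * score k - \sum_(k < K) v' 0 k * score k.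
    by rewrite -sumrB; apply: eq_bigr => k _; rewrite !mxE mulrBl.
  by rewrite /logdiff; lra.
apply: (le_trans (ler_normB _ _)); apply: lerD; last first.
  have := qform_dist n0 hX hr hD r0 D0.
  rewrite normrM [`|2^-1|]gtr0_norm ?invr_gt0//.
  by have := normr_ge0 (qform v - qform v'); lra.
rewrite (le_trans (ler_norm_sum _ _ _))//.
have -> : K%:R = \sum_(k < K) (1 : R) by rewrite sumr_const card_ord.
rewrite -big_split/= mulr_sumr; apply: ler_sum => k _.
rewrite normrM ler_pM// -[score k ^+ 2]real_normK ?num_real//.
by have := sqr_ge0 (`|score k| - 1); have := sqr_ge0 (`|score k|); nra.
Qed.

End likelihood.

Lemma ln_continuous_near (R : realType) (K : nat) (f : 'rV[R]_K -> R) (b0 : 'rV[R]_K) (e : R) :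
  continuous f -> (forall b, 0 < f b) -> 0 < e ->
  exists2 dl, 0 < dl & forall b, (forall k, `|(b - b0) 0 k| < dl) -> `|ln (f b) - ln (f b0)| <= e.
Proof.
move=> cf f0 e0.
have : {for b0, continuous (fun b => ln (f b))}.
  by apply: continuous_comp; [exact: cf|exact: continuous_ln].
move=> /cvgrPdist_le /(_ _ e0); rewrite near_simpl => /nbhs_ballP[dl /= dl0 H].
exists dl => // b hb; rewrite distrC; apply: H; split=> // i j.
by rewrite /ball/= (ord1 i); have := hb j; rewrite !mxE distrC.
Qed.

(** * Gaussian limit for weighted sums of the errors *)

Section triangular_array.
Context (R : realType) (dn : nat -> measure_display) (T : forall n, measurableType (dn n)).
Context (P : forall n, probability (T n) R).
Unset Implicit Arguments.
Variables (eps : forall n : nat, 'I_n -> T n -> R) (M : R).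
Hypothesis meps : forall n (i : 'I_n), measurable_fun setT (eps n i).
Hypothesis ieps : forall n, mutually_independent (P n) (eps n).
Hypothesis eps4 : forall n (i : 'I_n), ('E_(P n)[fun w => (eps n i w ^+ 4)%R] <= M%:E)%E.
Hypothesis eps1 : forall n (i : 'I_n), 'E_(P n)[eps n i] = 0%E.
Hypothesis eps2 : forall n (i : 'I_n), 'E_(P n)[fun w => (eps n i w ^+ 2)%R] = 1%E.
Variables (a : forall n : nat, 'I_n -> R) (s2 : R).
Hypothesis a2 : (fun n => \sum_(i < n) a n i ^+ 2) @ \oo --> s2.
Hypothesis a_small : forall e, 0 < e -> \forall n \near \oo, forall i, `|a n i| <= e.

Set Implicit Arguments.

Let S n w := \sum_(i < n) a n i * eps n i w.

Let charfun_bound e : 0 < e -> \forall n \near \oo,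
  `|mean (P n) (fun w => cos (S w)) - expR (- (\sum_(i < n) a n i ^+ 2) / 2)| <= e /\
  `|mean (P n) (fun w => sin (S w))| <= e.
Proof.
move=> e0.
have s20 : 0 <= s2.
  by apply: (cvgr_to_ge a2); apply: nearW => n; apply: sumr_ge0 => i _; exact: sqr_ge0.
(* Chosen so that [(|M| + 1) * (e / c) * (s2 + 1)] is [e / 2]. This quantity bounds the sum of the
   cubic errors once every weight is at most [e / c], and the cosine bound counts that sum twice. *)
pose c := 2 * ((`|M| + 1) * (s2 + 1)).
have c0 : 0 < c by have := normr_ge0 M; rewrite /c; nra.
have a2le : \forall n \near \oo, \sum_(i < n) a n i ^+ 2 <= s2 + 1.
  by apply: (@cvgr_le R nat \oo _ _ _ a2); rewrite ltrDl.
near=> n.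
have n1 : forall i, `|a n i| <= 1 by near: n; exact: a_small.
have ne : forall i, `|a n i| <= e / c by near: n; apply: a_small; rewrite divr_gt0.
have n2 : \sum_(i < n) a n i ^+ 2 <= s2 + 1.
  by near: n.
have [hc hs] := charfun_sum_indep (meps n) (ieps n)
  (fun i => norm_mean_cos_small (meps n i) (eps4 n i) (eps2 n i) (n1 i))
  (fun i => norm_mean_sin_small (meps n i) (eps4 n i) (eps1 n i) (a n i)).
have D : \sum_(i < n) (M + 1) * `|a n i| ^+ 3 <= e / 2.
  apply: (@le_trans _ _ (\sum_(i < n) (`|M| + 1) * (e / c) * a n i ^+ 2)).
    apply: ler_sum => i _; rewrite -mulrA.
    have -> : `|a n i| ^+ 3 = `|a n i| * a n i ^+ 2 by rewrite exprS real_normK ?num_real.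
    apply: (@le_trans _ _ ((`|M| + 1) * (`|a n i| * a n i ^+ 2))).
      apply: ler_wpM2r; first by apply: mulr_ge0 => //; exact: sqr_ge0.
      by rewrite lerD2r ler_norm.
    apply: ler_wpM2l; first exact: addr_ge0.
    by apply: ler_wpM2r => //; exact: sqr_ge0.
  rewrite -mulr_sumr; have M1 : 0 < `|M| + 1 by have := normr_ge0 M; lra.
  have s1 : 0 < s2 + 1 by lra.
  apply: (@le_trans _ _ ((`|M| + 1) * (e / c) * (s2 + 1))).
    by rewrite ler_wpM2l// mulr_ge0 ?ltW// divr_gt0.
  rewrite le_eqVlt; apply/orP; left; apply/eqP; rewrite /c; by field; rewrite !gt_eqF.
split; [apply: (le_trans hc)|apply: (le_trans hs)]; lra.
Unshelve. all: by end_near. Qed.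

Lemma triangular_cvg_cos : (fun n => mean (P n) (fun w => cos (S w))) @ \oo --> expR (- s2 / 2).
Proof.
have ce : (fun n => expR (- (\sum_(i < n) a n i ^+ 2) / 2)) @ \oo --> expR (- s2 / 2).
  apply: continuous_cvg; first exact: continuous_expR.
  by apply: cvgM; [exact: cvgN|exact: cvg_cst].
apply/cvgrPdist_le => e e0; have e20 : 0 < e / 2 by rewrite divr_gt0.
have /cvgrPdist_le /(_ _ e20) ce2 := ce.
near=> n.
have h1 : `|expR (- s2 / 2) - expR (- (\sum_(i < n) a n i ^+ 2) / 2)| <= e / 2 by near: n.
have [h2 _] : `|mean (P n) (fun w => cos (S w)) - expR (- (\sum_(i < n) a n i ^+ 2) / 2)| <= e / 2 /\
  `|mean (P n) (fun w => sin (S w))| <= e / 2 by near: n; exact: charfun_bound.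
rewrite (_ : _ - _ = (expR (- s2 / 2) - expR (- (\sum_(i < n) a n i ^+ 2) / 2))
  - (mean (P n) (fun w => cos (S w)) - expR (- (\sum_(i < n) a n i ^+ 2) / 2))); last by ring.
by rewrite (le_trans (ler_normB _ _))//; lra.
Unshelve. all: by end_near. Qed.

Lemma triangular_cvg_sin : (fun n => mean (P n) (fun w => sin (S w))) @ \oo --> (0 : R).
Proof.
apply/cvgrPdist_le => e /charfun_bound; apply: filterS => n [_].
by rewrite sub0r normrN.
Qed.

End triangular_array.

(** * Limits attached to the design matrix *)

Section design.
Context (R : realType) (K : nat).

Lemma dotvC (u v : 'rV[R]_K) : dotv u v = dotv v u.
Proof. by apply: eq_bigr => k _; rewrite mulrC. Qed.

Lemma sum_score (n : nat) (X : 'M[R]_(n, K)) (eps : 'I_n -> R) (v : 'rV[R]_K) :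
  \sum_(k < K) v 0 k * score X eps k =
  \sum_(i < n) dotv (row i X) v / Num.sqrt n%:R * eps i.
Proof.
under eq_bigr do rewrite mulr_sumr.
rewrite exchange_big/=; apply: eq_bigr => i _; rewrite /dotv !mulr_suml.
by apply: eq_bigr => k _; rewrite [row i X 0 k]mxE; ring.
Qed.

Lemma sum_sqr_div_sqrt (n : nat) (x : 'I_n -> R) :
  \sum_(i < n) (x i / Num.sqrt n%:R) ^+ 2 = (\sum_(i < n) x i ^+ 2) / n%:R.
Proof.
rewrite mulr_suml; apply: eq_bigr => i _.
by rewrite exprMn exprVn sqr_sqrtr.
Qed.

Lemma quadfZ (A : 'M[R]_K) (t : R) (u : 'rV[R]_K) : quadf A (t *: u) = t ^+ 2 * quadf A u.
Proof.
rewrite /quadf mulr_sumr; apply: eq_bigr => j _; rewrite mulr_sumr; apply: eq_bigr => k _.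
by rewrite !mxE; ring.
Qed.

Lemma cvg_bigsum (I : Type) (s : seq I) (F : I -> nat -> R) (l : I -> R) :
  (forall i, F i @ \oo --> l i) -> (fun n => \sum_(i <- s) F i n) @ \oo --> \sum_(i <- s) l i.
Proof.
move=> Fl; elim: s => [|i s IH].
  by rewrite big_nil; under eq_fun do rewrite big_nil; exact: cvg_cst.
by rewrite big_cons; under eq_fun do rewrite big_cons; exact: cvgD.
Qed.

Lemma qform_cvg (X : forall n : nat, 'M[R]_(n, K)) (Sigma : 'M[R]_K) (u : 'rV[R]_K) :
  (forall j k : 'I_K, (fun n => ((X n)^T *m X n) j k / n%:R) @ \oo --> Sigma j k) ->
  (fun n => qform (X n) u) @ \oo --> quadf Sigma u.
Proof.
move=> hlim.
have -> : (fun n => qform (X n) u) = (fun n =>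
    \sum_(j < K) \sum_(k < K) u 0 j * (((X n)^T *m X n) j k / n%:R) * u 0 k).
  apply/funext => n; rewrite /qform sum_dotv_sqr /quadf mulr_suml.
  by apply: eq_bigr => j _; rewrite mulr_suml; apply: eq_bigr => k _; ring.
apply: cvg_bigsum => j; apply: cvg_bigsum => k.
apply: cvgM; last exact: cvg_cst.
by apply: cvgM; [exact: cvg_cst|exact: hlim].
Qed.

Lemma logdiff0 (n : nat) (X : 'M[R]_(n, K)) (eps : 'I_n -> R) : logdiff X eps 0 = 0.
Proof.
rewrite /logdiff big1 ?sub0r => [|k _]; last by rewrite mxE mul0r.
rewrite /qform big1 ?mul0r ?oppr0// => i _.
by rewrite /dotv big1 ?expr0n// => k _; rewrite [X in _ * X]mxE mulr0.
Qed.

Lemma div_sqrtn_small (C e : R) : 0 < C -> 0 < e ->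
  \forall n \near \oo, C / Num.sqrt n%:R <= e.
Proof.
move=> C0 e0; exists (Num.truncn ((C / e) ^+ 2)).+1 => // n /= hn.
have h : (C / e) ^+ 2 <= n%:R.
  by rewrite ltW// (lt_le_trans (truncnS_gt _))// ler_nat.
have Ce : 0 < C / e by rewrite divr_gt0.
have n0 : (0 : R) < n%:R by apply: lt_le_trans h; rewrite exprn_gt0.
rewrite ler_pdivrMr ?sqrtr_gt0// mulrC -ler_pdivrMr//.
have -> : C / e = Num.sqrt ((C / e) ^+ 2) by rewrite sqrtr_sqr ger0_norm// ltW.
by rewrite ler_sqrt// ltW.
Qed.

End design.

(** * Removal of the deterministic part of the limit, and the limit theorem *)

Lemma cvg_dist_shift (R : realType) (dn : nat -> measure_display)
  (T : forall n, measurableType (dn n)) (P : forall n, probability (T n) R)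
  (X : forall n, T n -> R) d (Omega : measurableType d) (Q : probability Omega R)
  (W : Omega -> R) (c : R) :
  cvg_dist P (fun n w => X n w - c) Q W -> cvg_dist P X Q (fun w => c + W w).
Proof.
move=> H h hc [B hB]; have := H (fun x => h (c + x)).
have -> : (fun n => 'E_(P n)[fun w => h (c + (X n w - c))%R]) =
    (fun n => 'E_(P n)[fun w => h (X n w)]).
  by apply/funext => n; congr expectation; apply/funext => w; rewrite addrC subrK.
apply; last by exists B => x; exact: hB.
move=> x; apply: continuous_comp; last exact: hc.
by apply: cvgD; [exact: cvg_cst|exact: cvg_id].
Qed.
Unset Implicit Arguments.

Theorem theorem3 (R : realType) (K : nat) (hK : (0 < K)%N)
  (beta0 : 'rV[R]_K)
  (X : forall n : nat, 'M[R]_(n, K))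
  (Sigma0 : 'M[R]_K)
  (* (i) centred and scaled columns (for all large n) *)
  (hcent : \forall n \near \oo,
     forall k : 'I_K, \sum_(i < n) X n i k = 0 /\ \sum_(i < n) (X n i k) ^+ 2 = n%:R)
  (* (ii) max_i ||x_i|| / sqrt n -> 0 *)
  (hmax : (fun n => \big[Num.max/0]_(i < n) enorm (row i (X n)) / Num.sqrt n%:R)
            @ \oo --> (0 : R))
  (* (iii) X^t X positive definite (for all large n) *)
  (hpd : \forall n \near \oo, posdef ((X n)^T *m X n))
  (* (iv) X^t X / n -> Sigma0, Sigma0 positive definite *)
  (hlim : forall j k : 'I_K,
     (fun n => ((X n)^T *m X n) j k / n%:R) @ \oo --> Sigma0 j k)
  (hSigma0 : posdef Sigma0)
  (* errors: for each n, a probability space carrying eps_{n1},...,eps_{nn} *)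
  (dn : nat -> measure_display) (T : forall n, measurableType (dn n))
  (P : forall n, probability (T n) R)
  (eps : forall n : nat, 'I_n -> T n -> R)
  (heps_meas : forall n (i : 'I_n), measurable_fun setT (eps n i))
  (heps_indep : forall n, mutually_independent (P n) (eps n))
  (M : R)
  (heps4 : forall n (i : 'I_n), ('E_(P n)[fun w => (eps n i w ^+ 4)%R] <= M%:E)%E)
  (heps1 : forall n (i : 'I_n), 'E_(P n)[eps n i] = 0%E)
  (heps2 : forall n (i : 'I_n), 'E_(P n)[fun w => (eps n i w ^+ 2)%R] = 1%E)
  (* prior density f of beta: continuous, positive, integrating to 1 *)
  (f : 'rV[R]_K -> R)
  (hf_cont : continuous f) (hf_pos : forall b, 0 < f b)
  (hf_dens : leb_intK (fun b => (f b)%:E) = 1%E)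
  (beta1 : 'rV[R]_K) (C : R) (hC : 0 < C)
  (* limit: Z ~ N(0, Sigma0) on some probability space *)
  (d' : measure_display) (Omega : measurableType d') (Q : probability Omega R)
  (Z : 'I_K -> Omega -> R) (hZ : gaussian_vec Q Sigma0 Z) :
  let Y := fun n (i : 'I_n) (w : T n) =>
    (dotv (row i (X n)) ((Num.sqrt n%:R)^-1 *: beta0) + eps n i w)%R in
  let Ystar := fun n (i : 'I_n) (w : T n) => (Num.sqrt n%:R * Y n i w)%R in
  let lik := fun n (w : T n) (b : 'rV[R]_K) =>
    (\prod_(i < n) npdf (dotv (row i (X n)) b) n%:R (Ystar n i w))%R in
  let post := fun n (w : T n) (A : set 'rV[R]_K) => posterior f (lik n w) A in
  cvg_dist P
    (fun n w => ln (post n w (eball beta1 (C / Num.sqrt n%:R))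
                    / post n w (eball beta0 (C / Num.sqrt n%:R)))%R)
    Q
    (fun w => (ln (f beta1 / f beta0) - quadf Sigma0 (beta1 - beta0) / 2
              + \sum_(k < K) (beta1 - beta0) 0 k * Z k w)%R).
Proof.
move=> Y Ystar lik post; set u := beta1 - beta0.
pose a n (i : 'I_n) := dotv (row i (X n)) u / Num.sqrt n%:R.
pose S n w := \sum_(i < n) a n i * eps n i w.
pose sc n (w : T n) := score (X n) (fun i => eps n i w).
(* For large [n] each squared score has mean 1, by the normalisation of the columns, so [G] has mean
   [1 + K]. The summand 1 lets deterministic errors be absorbed into multiples of [G]. *)
pose G n (w : T n) := 1 + \sum_(k < K) sc n w k ^+ 2.
pose W w := \sum_(k < K) u 0 k * Z k w.
(* One constant for two bounds: it exceeds the limit [quadf Sigma0 u] of the second moments of [S],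
   and also [1 + K]. *)
pose V := `|quadf Sigma0 u| + K%:R + 2.
have V0 : 0 < V by rewrite ltr_wpDl// addr_ge0.
have a2 : (fun n => \sum_(i < n) a n i ^+ 2) @ \oo --> quadf Sigma0 u.
  rewrite (_ : (fun _ => _) = fun n => qform (X n) u); first exact: qform_cvg.
  by apply/funext => n; rewrite /a sum_sqr_div_sqrt.
pose U := \sum_(k < K) `|u 0 k|.
have U0 : 0 <= U by apply: sumr_ge0.
have asmall e : 0 < e -> \forall n \near \oo, forall i, `|a n i| <= e.
  move=> e0; have e10 : 0 < e / (U + 1) by rewrite divr_gt0// ltr_wpDl.
  have /cvgrPdist_le /(_ _ e10) := hmax; apply: filterS => n; rewrite /= sub0r normrN => hn i.
  have hi : enorm (row i (X n)) / Num.sqrt n%:R <= e / (U + 1).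
    apply: le_trans (le_trans (ler_norm _) hn).
    rewrite ler_wpM2r ?invr_ge0 ?sqrtr_ge0//.
    exact: (le_bigmax _ (fun i => enorm (row i (X n)))).
  rewrite /a normrM [`|_^-1|]ger0_norm ?invr_ge0 ?sqrtr_ge0// dotvC.
  apply: (@le_trans _ _ (enorm (row i (X n)) * U / Num.sqrt n%:R)).
    rewrite ler_wpM2r ?invr_ge0 ?sqrtr_ge0//; apply: norm_dotv_le => k.
    exact: coord_le_enorm.
  rewrite mulrAC (le_trans (ler_wpM2r U0 hi))// mulrAC ler_pdivrMr; last by rewrite ltr_wpDl.
  by rewrite ler_pM2l// lerDl.
(* Frequency [t] amounts to weights [t * a], so the triangular array results at frequency 1 cover
   all characteristic functions. *)
have ta2 t : (fun n => \sum_(i < n) (t * a n i) ^+ 2) @ \oo --> t ^+ 2 * quadf Sigma0 u.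
  rewrite (_ : (fun _ => _) = fun n => t ^+ 2 * \sum_(i < n) a n i ^+ 2).
    by apply: cvgM => //; exact: cvg_cst.
  by apply/funext => n; rewrite mulr_sumr; apply: eq_bigr => i _; rewrite exprMn.
have tasmall t e : 0 < e -> \forall n \near \oo, forall i, `|t * a n i| <= e.
  move=> e0; have t0 : 0 < `|t| + 1 by rewrite ltr_wpDl.
  have /asmall : 0 < e / (`|t| + 1) by rewrite divr_gt0.
  apply: filterS => n hn i; rewrite normrM.
  apply: (@le_trans _ _ ((`|t| + 1) * (e / (`|t| + 1)))).
    by apply: ler_pM => //; rewrite lerDl.
  by rewrite mulrC divfK// gt_eqF.
have itgsc n k : itg (P n) (fun w => sc n w k ^+ 2).
  exact: (itg_sum_sqr (heps_meas n) (heps4 n)).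
apply: (@cvg_dist_shift _ _ _ _ _ _ _ _ W (ln (f beta1 / f beta0) - quadf Sigma0 u / 2)).
apply: (@cvg_dist_of_charfun _ _ _ _ _ _ _ _ S G W V) => //.
- move=> n; apply: measurable_fun_bigsum => i; exact: measurable_funM.
- apply: measurable_fun_bigsum => k; apply: measurable_funM => //; exact: hZ.1.
- by move=> n; exact: (itg_sum_sqr (heps_meas n) (heps4 n)).
- have : \forall n \near \oo, \sum_(i < n) a n i ^+ 2 <= V.
    apply: (@cvgr_le R nat \oo _ _ _ a2); rewrite /V.
    by have := ler_norm (quadf Sigma0 u); have := ler0n R K; lra.
  apply: filterS => n.
  by rewrite (mean_sum_sqr (heps_meas n) (heps_indep n) (heps4 n) (heps1 n) (heps2 n)).
- move=> n; apply: itgD; [exact: itg_cst|by apply: itg_sum => k].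
- by move=> n w; rewrite addr_ge0// sumr_ge0// => k _; exact: sqr_ge0.
- near=> n.
  have n0 : (0 < n)%N by near: n; exact: nbhs_infty_gt.
  have hX : forall k : 'I_K, \sum_(i < n) X n i k = 0 /\
      \sum_(i < n) (X n i k) ^+ 2 = n%:R by near: n.
  rewrite meanD; [|exact: itg_cst|by apply: itg_sum => k].
  rewrite mean_cst mean_sum// (eq_bigr (fun=> 1)) => [|k _].
    by rewrite sumr_const card_ord /V; have := normr_ge0 (quadf Sigma0 u); lra.
  rewrite (mean_sum_sqr (heps_meas n) (heps_indep n) (heps4 n) (heps1 n) (heps2 n)).
  by rewrite sum_sqr_div_sqrt (hX k).2 divff// pnatr_eq0 -lt0n.
- move=> t.
  have -> : mean Q (fun w => cos (t * W w)) = expR (- (t ^+ 2 * quadf Sigma0 u) / 2).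
    have [hc _] := hZ.2 (t *: u); rewrite quadfZ in hc.
    rewrite (_ : (fun w => cos (t * W w)) = (fun w => cos (\sum_(k < K) (t *: u) 0 k * Z k w))).
      by rewrite mean_fine hc.
    apply/funext => w; congr cos; rewrite mulr_sumr; apply: eq_bigr => k _.
    by rewrite [(t *: u) 0 k]mxE mulrA.
  rewrite (_ : (fun n => mean (P n) (fun w => cos (t * S n w))) =
    (fun n => mean (P n) (fun w => cos (\sum_(i < n) (t * a n i) * eps n i w)))).
    exact: (triangular_cvg_cos heps_meas heps_indep heps4 heps1 heps2 (ta2 t) (tasmall t)).
  apply/funext => n; congr mean; apply/funext => w; congr cos.
  by rewrite mulr_sumr; apply: eq_bigr => i _; rewrite mulrA.
- move=> t.
  have -> : mean Q (fun w => sin (t * W w)) = 0.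
    have [_ hs] := hZ.2 (t *: u).
    rewrite (_ : (fun w => sin (t * W w)) = (fun w => sin (\sum_(k < K) (t *: u) 0 k * Z k w))).
      by rewrite mean_fine hs.
    apply/funext => w; congr sin; rewrite mulr_sumr; apply: eq_bigr => k _.
    by rewrite [(t *: u) 0 k]mxE mulrA.
  rewrite (_ : (fun n => mean (P n) (fun w => sin (t * S n w))) =
    (fun n => mean (P n) (fun w => sin (\sum_(i < n) (t * a n i) * eps n i w)))).
    exact: (triangular_cvg_sin heps_meas heps_indep heps4 heps1 heps2 (ta2 t) (tasmall t)).
  apply/funext => n; congr mean; apply/funext => w; congr sin.
  by rewrite mulr_sumr; apply: eq_bigr => i _; rewrite mulrA.
- move=> e e0.
  have e80 : 0 < e / 8 by rewrite divr_gt0.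
  have e20 : 0 < e / 2 by rewrite divr_gt0.
  have [dl1 dl10 hdl1] := ln_continuous_near beta1 hf_cont hf_pos e80.
  have [dl0 dl00 hdl0] := ln_continuous_near beta0 hf_cont hf_pos e80.
  (* Coordinatewise bound for [(b - beta0) + (bj - beta0)], which is [(b - bj)] plus twice
     [bj - beta0]; the radius is at most [C] for large [n]. *)
  pose D := C + 2 * U; have D0 : 0 <= D by rewrite addr_ge0 ?mulr_ge0// ltW.
  (* Collects the deterministic coefficients of the radius in [logdiff_dist]. The extra 1 gives
     [q >= 1], so that [r <= e / 8] holds as well. *)
  pose q := K%:R + D * K%:R ^+ 2 + 1 : R.
  have q1 : 1 <= q by rewrite lerDr addr_ge0// mulr_ge0// exprn_ge0.
  have eq0 : 0 < e / 8 / q by rewrite divr_gt0// (lt_le_trans ltr01).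
  have qcvg : (fun n => qform (X n) u) @ \oo --> quadf Sigma0 u by exact: qform_cvg.
  (* [n] is fixed before [w]: every threshold below is deterministic, and all randomness is left in
     [G]. *)
  near=> n; move=> w.
  have n0 : (0 < n)%N by near: n; exact: nbhs_infty_gt.
  have nR : (0 : R) < Num.sqrt n%:R by rewrite sqrtr_gt0 ltr0n.
  have hX : forall k : 'I_K, \sum_(i < n) X n i k = 0 /\
      \sum_(i < n) (X n i k) ^+ 2 = n%:R by near: n.
  have rC : C / Num.sqrt n%:R <= C by near: n; exact: div_sqrtn_small.
  have rq : C / Num.sqrt n%:R <= e / 8 / q by near: n; exact: div_sqrtn_small.
  have rd1 : C / Num.sqrt n%:R <= dl1 by near: n; exact: div_sqrtn_small.
  have rd0 : C / Num.sqrt n%:R <= dl0 by near: n; exact: div_sqrtn_small.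
  pose r := C / Num.sqrt n%:R; have r0 : 0 < r by rewrite divr_gt0.
  rewrite -/r in rC rq rd1 rd0.
  have hq : `|quadf Sigma0 u - qform (X n) u| <= e / 2.
    by near: n; have /cvgrPdist_le := qcvg; exact.
  have [A A0 AE] := likelihoodE (X n) beta0 (fun i => eps n i w) n0.
  have [cL hcL] := likelihood_le (X n) beta0 (fun i => eps n i w).
  have L0 b : 0 < lik n w b by rewrite [lik n w b]AE mulr_gt0// expR_gt0.
  have G1 : 1 <= G n w by rewrite lerDl sumr_ge0// => k _; exact: sqr_ge0.
  have lnE b : ln (f b * lik n w b) =
      ln (f b) + ln A + logdiff (X n) (fun i => eps n i w) (b - beta0).
    by rewrite [lik n w b]AE !lnM ?posrE ?mulr_gt0 ?expR_gt0// expRK addrA.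
  (* Within one ball the prior costs [e / 8] and the likelihood at most [e / 8 * G]. The two balls
     together cost [e / 2 * G] and the quadratic form at most [e / 4], which stays below [e * G]
     since [G >= 1]. *)
  have ball_bound bj : (forall k, `|(bj - beta0) 0 k| <= U) ->
      (forall b, (forall k, `|(b - bj) 0 k| < r) -> `|ln (f b) - ln (f bj)| <= e / 8) ->
      forall b, eball bj r b -> `|ln (f b * lik n w b) - ln (f bj * lik n w bj)| <= e / 4 * G n w.
    move=> bjU hbj b hb.
    have cb k : `|(b - bj) 0 k| < r by exact: le_lt_trans (coord_le_enorm _ _) hb.
    have v1 k : `|(b - beta0 - (bj - beta0)) 0 k| <= r.
      by rewrite opprB addrA subrK ltW.
    have v2 k : `|(b - beta0 + (bj - beta0)) 0 k| <= D.
      rewrite (_ : b - beta0 + (bj - beta0) = (b - bj) + (2%:R : R) *: (bj - beta0)); last first.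
        by rewrite scaler_nat mulr2n [RHS]addrA; congr (_ + _); rewrite [RHS]addrA subrK.
      rewrite mxE (le_trans (ler_normD _ _))// /D lerD//; first by rewrite (le_trans (ltW (cb k))).
      by rewrite mxE normrM ger0_norm// ler_pM2l.
    have := logdiff_dist (fun i => eps n i w) n0 (fun k => (hX k).2) v1 v2 (ltW r0) D0.
    rewrite -/(sc n w) => hl.
    rewrite !lnE.
    set l1 := logdiff _ _ _ in hl *; set l2 := logdiff _ _ _ in hl *.
    have hf := hbj b cb.
    rewrite (_ : _ - _ = (ln (f b) - ln (f bj)) + (l1 - l2)); last by ring.
    apply: (le_trans (ler_normD _ _)).
    apply: (le_trans (lerD hf hl)).
    set s := \sum_(k < K) sc n w k ^+ 2.
    have s0 : 0 <= s by apply: sumr_ge0 => k _; exact: sqr_ge0.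
    have rq' : r * q <= e / 8 by rewrite -ler_pdivlMr// (lt_le_trans ltr01).
    have rs : r * s <= e / 8 * s.
      rewrite ler_wpM2r// (le_trans rq)// ler_pdivrMr; last by rewrite (lt_le_trans ltr01).
      by rewrite ler_peMr// ltW.
    have -> : r * (K%:R + s) + r * D * K%:R ^+ 2 = r * q - r + r * s by rewrite /q; ring.
    by rewrite /G -/s; nra.
  have h1 : forall b, eball beta1 r b ->
      `|ln (f b * lik n w b) - ln (f beta1 * lik n w beta1)| <= e / 4 * G n w.
    apply: ball_bound => [k|b hb].
      by rewrite /U (bigD1 k)//= lerDl sumr_ge0.
    by apply: hdl1 => k; exact: lt_le_trans (hb k) rd1.
  have h0 : forall b, eball beta0 r b ->
      `|ln (f b * lik n w b) - ln (f beta0 * lik n w beta0)| <= e / 4 * G n w.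
    apply: ball_bound => [k|b hb].
      by rewrite subrr mxE normr0.
    by apply: hdl0 => k; exact: lt_le_trans (hb k) rd0.
  have := ln_posterior_ratio hf_pos L0 r0 hf_dens hcL h1 h0.
  (* At the centre [beta0] the log-likelihood difference vanishes and [ln A] cancels. What remains
     is the difference of the log prior densities plus [S n w - qform (X n) u / 2]. *)
  rewrite !lnE subrr logdiff0 addr0 -/u /logdiff sum_score -/(S n w) /post -/r.
  rewrite [ln (f beta1 / f beta0)]ln_div ?posrE//.
  set lr := ln (posterior _ _ _ / _); move: hq; rewrite !ler_norml => /andP[? ?] /andP[? ?].
  have eG : e <= e * G n w by rewrite ler_peMr// ltW.
  by apply/andP; split; lra.
Unshelve. all: by end_near. Qed.
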